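(* Let $(Y^n)_{n\ge 1}$ be a sequence of centred Gaussian vectors $Y^n=(Y^{(n)}_1,\dots,Y^{(n)}_n)$ such that for every $n\ge 1$ the elements $Y^{(n)}_k$, $k=1,\dots,n$, belong to the first Wiener chaos. Let $\lambda^n_1,\dots,\lambda^n_n$ be the eigenvalues of the covariance matrix of $Y^n$ and let $V_n=\sum_{k=1}^n\left[(Y^{(n)}_k)^2-\mathbb{E}(Y^{(n)}_k)^2\right]$. If $$\lambda^*(n):=\max_{k=1,\dots,n}|\lambda^n_k|=o\left(\sqrt{\mathrm{Var}(V_n)}\right),\qquad n\to\infty,$$ then $$\frac{V_n}{\sqrt{\mathrm{Var}(V_n)}}\to\mathcal{N}(0,1)$$ in distribution.
   Context: The first Wiener chaos of a separable centred Gaussian process $X$ is the closed linear subspace of $L^2(\Omega)$ spanned by the random variables of $X$; all its elements are centred and jointly Gaussian. The covariance matrix of $Y^n$ has entries $\mathbb{E}[Y^{(n)}_jY^{(n)}_k]$. $a_n=o(b_n)$ means $|a_n|/|b_n|\to0$. It is understood that $\mathrm{Var}(V_n)>0$. *)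

(* Defs.v *)
From HB Require Import structures.
From mathcomp Require Import all_boot all_order all_algebra.
From mathcomp Require Import all_classical all_reals all_analysis.
From mathcomp Require Import measurable_realfun.

Set Implicit Arguments.
Unset Strict Implicit.
Unset Printing Implicit Defensive.

Import Order.TTheory GRing.Theory Num.Theory.
Import numFieldNormedType.Exports.

Local Open Scope classical_set_scope.
Local Open Scope ring_scope.

Section Gaussian.
Context {R : realType} {d : measure_display} {Omega : measurableType d}.
Context {P : probability Omega R}.
Implicit Types (Z W : {RV P >-> R}) (A : set {RV P >-> R}).

(* [normal_prob m s] has mean [m] and standard deviation [s], but for [s = 0]
   it is a uniform law by convention; Gaussian variables may be degenerate, so
   that case is replaced by the point mass at [m]. *)
Definition gaussian_law (m s : R) : set R -> \bar R :=
  if s == 0 then dirac m else normal_prob m s.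

Definition gaussian_rv Z : Prop := exists m s : R,
  forall B : set (measurableTypeR R), measurable B ->
    distribution P Z B = gaussian_law m s B.

Definition gaussian_vector n (Y : 'I_n -> {RV P >-> R}) : Prop :=
  forall a : 'I_n -> R,
    gaussian_rv (\sum_(i < n) a i *: Y i : {mfun Omega >-> R}).

Definition centred I (X : I -> {RV P >-> R}) : Prop :=
  forall i, ('E_P[X i] = 0)%E.

Definition gaussian_process I (X : I -> {RV P >-> R}) : Prop :=
  forall n (t : 'I_n -> I), gaussian_vector (X \o t).

Definition linear_span I (X : I -> {RV P >-> R}) : set {RV P >-> R} :=
  [set Z | exists n (t : 'I_n -> I) (c : 'I_n -> R),
     Z = (\sum_(i < n) c i *: X (t i) : {mfun Omega >-> R})].

(* Random variables are actual functions here, so a closure in L^2 contains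
   all the versions of its elements. *)
Definition L2_closure A : set {RV P >-> R} :=
  [set Z | (Z : Omega -> R) \in Lfun P 2%:E /\
     forall e : R, 0 < e ->
       exists2 W, A W & ('N[P]_2%:E[EFin \o (Z \- W)%R] < e%:E)%E].

Definition first_chaos I (X : I -> {RV P >-> R}) : set {RV P >-> R} :=
  L2_closure (linear_span X).

(* Separability for the canonical metric of the process, i.e. the L^2 distance
   between X s and X t; equivalently, the Hilbert space [first_chaos X] is
   separable.  For a Gaussian process this is implied by Doob separability and
   needs no topology on the index set. *)
Definition separable_process I (X : I -> {RV P >-> R}) : Prop :=
  exists D : set I, countable D /\ range X `<=` L2_closure (X @` D).

Definition covariance_matrix n (Y : 'I_n -> {RV P >-> R}) : 'M[R]_n :=
  \matrix_(j, k) fine 'E_P[Y j \* Y k].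

Definition centred_square_sum n (Y : 'I_n -> {RV P >-> R}) : {RV P >-> R} :=
  \sum_(k < n)
    (Y k \* Y k \- cst (fine 'E_P[Y k \* Y k]) : {mfun Omega >-> R}).

Definition cvg_in_distribution (Z : nat -> {RV P >-> R})
    (mu : probability (measurableTypeR R) R) : Prop :=
  forall x : R, {for x, continuous (fun y : R => mu `]-oo, y]%classic)} ->
    cdf (Z n) x @[n --> \oo] --> mu `]-oo, x]%classic.

End Gaussian.

(* [l] lists the eigenvalues of [A] with their algebraic multiplicities. *)
Definition eigenvalues (F : fieldType) n (A : 'M[F]_n) (l : 'I_n -> F) : Prop :=
  char_poly A = \prod_(k < n) ('X - (l k)%:P).

(* Main.v *)
Require Import Defs.
From mathcomp Require Import all_boot all_order all_algebra.
From mathcomp Require Import all_classical all_reals all_analysis.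
From mathcomp Require Import measurable_realfun.
From mathcomp Require Import ring lra.

(** The proof is Stein's method for a quadratic form in a Gaussian vector, with
    a Gaussian integration by parts obtained from Laplace transforms.

    Fix [n] and diagonalize the covariance matrix by an orthogonal matrix
    ([orthogonal_diagonalization]).  The rotated coordinates [U j] satisfy
    [V = T - m], where [T = \sum_j U j ^+ 2] and [m = \sum_j l j], the [l j]
    being eigenvalues of the covariance matrix; every linear form
    [\sum_j a j * U j] is Gaussian with variance [\sum_j a j ^+ 2 * l j].  The
    cosine transforms of linear forms determine, by averaging over Gaussian
    coefficients [a j], the means of [expR (- \sum_j s j * U j ^+ 2)]
    ([mixed_transform], [laplace_squares]).  Their derivatives in the [s j]
    ([weighted_square_mean]) say that, with [Q = \sum_j l j * U j ^+ 2],
<<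
      E [(T - m) * f T] = 2 * E [Q * f' T]
>>
    for [f] an exponential [fun x => expR (- s * x)].  Weierstrass approximation
    extends this to every continuously differentiable [f] with bounded
    derivative ([laplace_extension]).

    Put [sigma ^+ 2 = Var V = 2 * \sum_j l j ^+ 2] and [Z = V / sigma].  For a
    continuous [h] with values in the unit interval, the Stein equation
    [g' x - x * g x = h x - c], with [c] the mean of [h] for the standard normal
    law, has a solution with [`|g'| <= 2] ([stein_solution]).  The identity above
    for [f x = g ((x - m) / sigma)] turns the error into
<<
      E [h Z] - c = E [g' Z * (1 - 2 * Q / sigma ^+ 2)].
>>
    Since [2 * Q / sigma ^+ 2] has mean 1 and the variance of [Q] is
    [2 * \sum_j l j ^+ 4], the error is at most [4 * L / sigma] for every bound [L]
    of the eigenvalues ([chi_square_stein_bound]).  The hypothesis makes this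
    tend to 0 uniformly in [h]; taking piecewise linear [h] close to indicators of
    half-lines gives the convergence of distribution functions at the continuity
    points of the limit ([cdf_smooth_bounds]). *)

Set Implicit Arguments.
Unset Strict Implicit.
Unset Printing Implicit Defensive.

Import Order.TTheory GRing.Theory Num.Theory.
Import numFieldNormedType.Exports.

Local Open Scope classical_set_scope.
Local Open Scope ring_scope.

(** * Orthogonal diagonalization of real symmetric matrices *)

Lemma dot_gt0 (R : rcfType) n (v : 'rV[R]_n) : v != 0 -> 0 < (v *m v^T) 0 0.
Proof.
move=> v0; rewrite mxE; have [j vj] : exists j, v 0 j != 0.
  apply/existsP; apply: contraNT v0 => /existsPn v0.
  by apply/eqP/rowP => j; rewrite mxE; apply/eqP; move: (v0 j); rewrite negbK.
rewrite (bigD1 j)//= mxE ltr_wpDr//; last by rewrite -expr2 exprn_even_gt0.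
by apply: sumr_ge0 => i _; rewrite mxE -expr2 sqr_ge0.
Qed.

(** Reflecting across the hyperplane orthogonal to [e - u] moves one unit vector
    to another by an explicit symmetric involution, so no basis has to be
    completed by Gram-Schmidt. *)
Lemma householder_reflection (R : rcfType) n (e u : 'rV[R]_n) :
  e *m e^T = 1%:M -> u *m u^T = 1%:M ->
  exists H : 'M[R]_n, [/\ H^T = H, H *m H = 1%:M & e *m H = u].
Proof.
move=> e1 u1; have [->|ue] := eqVneq e u.
  by exists 1%:M; rewrite trmx1 !mulmx1.
pose v := e - u; pose t := (e *m u^T) 0 0; pose c := 2 * (1 - t).
have eu : e *m u^T = t%:M by rewrite [LHS]mx11_scalar.
have ue' : u *m e^T = t%:M by rewrite -(trmxK u) -trmx_mul eu tr_scalar_mx.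
have ev : e *m v^T = (c / 2)%:M.
  rewrite linearB /= mulmxBr e1 eu -raddfB /=; congr _%:M.
  by rewrite /c; field.
have vv : v *m v^T = c%:M.
  rewrite mulmxBl ev linearB /= mulmxBr u1 ue' -!raddfB /=; congr _%:M.
  by rewrite /c; field.
have c0 : c != 0.
  have : v != 0 by rewrite subr_eq0.
  by move/dot_gt0; rewrite vv !mxE eqxx mulr1n => /gt_eqF ->.
exists (1%:M - (2 / c) *: (v^T *m v)); split.
- by rewrite linearB /= linearZ /= trmx1 trmx_mul trmxK.
- have PP : (v^T *m v) *m (v^T *m v) = c *: (v^T *m v).
    by rewrite -mulmxA (mulmxA v) vv mul_scalar_mx -scalemxAr.
  move: (v^T *m v) PP => p pp.
  rewrite mulmxBl mul1mx mulmxBr mulmx1 -scalemxAr -scalemxAl pp !scalerA.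
  have -> : 2 / c * (2 / c) * c = 2 / c + 2 / c by field; exact: c0.
  by rewrite scalerDl opprB addrK subrK.
- rewrite mulmxBr mulmx1 -scalemxAr mulmxA ev mul_scalar_mx scalerA.
  rewrite (_ : _ * _ = 1) ?scale1r /v ?subKr//; field; exact: c0.
Qed.

(** Deflation: a real root of the characteristic polynomial has a unit
    eigenvector; the reflection carrying the first basis vector to it conjugates
    the matrix to a block-diagonal one, whose remaining block is symmetric and
    has the remaining roots.  The splitting hypothesis provides the real
    eigenvalue at every stage, which avoids a detour through the complex
    numbers. *)
Lemma orthogonal_diagonalization (R : rcfType) n (A : 'M[R]_n) (s : seq R) :
  A^T = A -> char_poly A = \prod_(x <- s) ('X - x%:P) ->
  exists (Q : 'M[R]_n) (D : 'rV[R]_n),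
    Q *m Q^T = 1%:M /\ Q *m A *m Q^T = diag_mx D.
Proof.
elim: n A s => [|n IH] A s symA.
  by exists 1%:M, 0; split; apply/matrixP => -[].
case: s => [|l s].
  by rewrite big_nil => /(congr1 (fun p : {poly R} => size p)); rewrite size_char_poly size_poly1.
rewrite big_cons => chA.
have /eigenvalueP[w wA w0] : eigenvalue A l.
  by rewrite eigenvalue_root_char chA rootM root_XsubC eqxx.
pose u := (Num.sqrt ((w *m w^T) 0 0))^-1 *: w.
have w2 := dot_gt0 w0.
have uA : u *m A = l *: u by rewrite -scalemxAl wA !scalerA mulrC.
have u1 : u *m u^T = 1%:M.
  rewrite linearZ /= -scalemxAl -scalemxAr scalerA -invfM -expr2.
  rewrite sqr_sqrtr ?ltW// [w *m _]mx11_scalar scale_scalar_mx mxE eqxx mulr1n.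
  by rewrite mulVf ?gt_eqF.
have e1 : (delta_mx 0 0 : 'rV[R]_(1 + n)) *m (delta_mx 0 0)^T = 1%:M.
  by rewrite trmx_delta mul_delta_mx; apply/matrixP => i j; rewrite !mxE !ord1 eqxx.
have [H [symH HH eH]] := householder_reflection e1 u1.
have [B defB] : exists B : 'M[R]_(1 + n), B = H *m A *m H by exists (H *m A *m H).
have symB : B^T = B by rewrite defB !trmx_mul symH symA mulmxA.
have eB : delta_mx 0 0 *m B = l *: (delta_mx 0 0 : 'rV[R]_(1 + n)).
  by rewrite defB !mulmxA eH uA -scalemxAl -eH -mulmxA HH mulmx1.
have Bs : B = block_mx l%:M 0 0 (drsubmx B).
  have B0 j : B 0 j = l * (j == 0)%:R.
    by have /rowP/(_ j) := eB; rewrite -rowE !mxE.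
  have l0 (i : 'I_1) : lshift n i = (0 : 'I_n.+1) by rewrite ord1; exact/val_inj.
  rewrite -[LHS]submxK; congr block_mx; apply/matrixP => i j; rewrite !mxE.
  - by rewrite !ord1 l0 B0 eqxx mulr1.
  - by rewrite l0 B0 mulr0.
  - by rewrite -symB mxE l0 B0 mulr0.
have chB : char_poly B = char_poly A.
  have HHp : map_mx polyC H *m map_mx polyC H = 1%:M by rewrite -map_mxM HH map_mx1.
  rewrite /char_poly (_ : char_poly_mx B = map_mx polyC H *m char_poly_mx A *m map_mx polyC H).
    by rewrite !det_mulmx mulrAC -det_mulmx HHp det1 mul1r.
  rewrite /char_poly_mx mulmxBr mulmxBl defB !map_mxM; congr (_ - _).
  by rewrite scalar_mxC -mulmxA HHp mulmx1.
have [||Q [D [QQ QD]]] := IH (drsubmx B) s.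
- by rewrite -[in RHS]symB; apply/matrixP => i j; rewrite !mxE.
- apply: (mulfI (negbT (polyXsubC_eq0 l))).
  rewrite -chA -chB {2}Bs /char_poly char_block_diag_mx det_ublock; congr (_ * _).
  by rewrite det_mx11 !mxE eqxx.
pose P : 'M[R]_(1 + n) := block_mx 1%:M 0 0 Q.
have trP : P^T = block_mx 1%:M 0 0 Q^T by rewrite /P tr_block_mx !trmx0 trmx1.
have PBP : P *m B *m P^T = diag_mx (row_mx l%:M D).
  rewrite trP Bs /P !mulmx_block !mulmx0 !mul0mx !mulmx1 !mul1mx !addr0 !add0r.
  rewrite QD diag_mx_row; congr block_mx; last by rewrite mul0mx.
  by apply/matrixP => i j; rewrite !mxE !ord1.
exists (P *m H), (row_mx l%:M D).
have PP : P *m P^T = 1%:M.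
  rewrite trP /P mulmx_block !mulmx0 !mul0mx !mulmx1 !addr0.
  by rewrite add0r QQ scalar_mx_block.
split; first by rewrite trmx_mul symH -mulmxA (mulmxA H) HH mul1mx.
by rewrite -PBP defB trmx_mul symH !mulmxA.
Qed.

(** The rows of the orthogonal matrix are eigenvectors.  This relates the
    diagonal entries to any given list of eigenvalues without matching the two
    lists up to a permutation. *)
Lemma diagonal_entry_root (R : rcfType) n (A Q : 'M[R]_n) (D : 'rV[R]_n) j :
  Q *m Q^T = 1%:M -> Q *m A *m Q^T = diag_mx D -> root (char_poly A) (D 0 j).
Proof.
move=> QQ QD; rewrite -eigenvalue_root_char; apply/eigenvalueP.
exists (row j Q).
  have QA : Q *m A = diag_mx D *m Q.
    by rewrite -QD -!mulmxA (mulmx1C QQ) mulmx1.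
  by rewrite -row_mul QA; apply/rowP => k; rewrite mul_diag_mx !mxE.
apply/eqP => Qj; have /matrixP/(_ j j) := QQ.
rewrite !mxE eqxx big1 => [/eqP|i _]; first by rewrite eq_sym oner_eq0.
by have /rowP/(_ i) := Qj; rewrite !mxE => ->; rewrite mul0r.
Qed.

(** * Real-valued integrals *)

Section Measure.
Context d (T : measurableType d) (R : realType) (mu : {measure set T -> \bar R}).
Implicit Types f g : T -> R.

Lemma dominated_integrable f g : measurable_fun setT f ->
  (forall x, `|f x| <= g x) -> mu.-integrable setT (EFin \o g) ->
  mu.-integrable setT (EFin \o f).
Proof.
move=> mf fg ig; apply: (@le_integrable _ _ _ mu _ measurableT _ (EFin \o g)) => //.
  exact/measurable_EFinP.
move=> x _ /=; rewrite lee_fin (le_trans (fg x))//; exact: ler_norm.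
Qed.

Lemma integrableD_EFin f g : mu.-integrable setT (EFin \o f) ->
  mu.-integrable setT (EFin \o g) ->
  mu.-integrable setT (EFin \o (fun x => f x + g x)).
Proof. by move=> mf mg; exact: (integrableD measurableT mf mg). Qed.

Lemma integrableZ_EFin (k : R) f : mu.-integrable setT (EFin \o f) ->
  mu.-integrable setT (EFin \o (fun x => k * f x)).
Proof. by move=> mf; exact: (integrableZl measurableT _ mf). Qed.

Lemma integrableB_EFin f g : mu.-integrable setT (EFin \o f) ->
  mu.-integrable setT (EFin \o g) ->
  mu.-integrable setT (EFin \o (fun x => f x - g x)).
Proof. by move=> mf mg; exact: (integrableB measurableT mf mg). Qed.

Lemma integrable_sum_EFin (I : Type) (r : seq I) (F : I -> T -> R) :
  (forall i, mu.-integrable setT (EFin \o F i)) ->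
  mu.-integrable setT (EFin \o (fun x => \sum_(i <- r) F i x)).
Proof.
move=> iF; elim: r => [|i r IH].
  by apply: eq_integrable (@integrable0 _ _ _ mu _) => // x _; rewrite /= big_nil.
by apply: eq_integrable (integrableD_EFin (iF i) IH) => // x _; rewrite /= big_cons.
Qed.

Lemma Rintegral_sum (I : Type) (r : seq I) (F : I -> T -> R) :
  (forall i, mu.-integrable setT (EFin \o F i)) ->
  \int[mu]_x (\sum_(i <- r) F i x) = \sum_(i <- r) \int[mu]_x F i x.
Proof.
move=> iF; elim: r => [|i r IH].
  rewrite big_nil; under eq_Rintegral do rewrite big_nil.
  by rewrite Rintegral_cst// mul0r.
rewrite big_cons -IH -RintegralD//; last exact: integrable_sum_EFin.
by apply: eq_Rintegral => x _; rewrite big_cons.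
Qed.

Lemma Rintegral_norm_le f g : measurable_fun setT f ->
  (forall x, `|f x| <= g x) -> mu.-integrable setT (EFin \o g) ->
  `|\int[mu]_x f x| <= \int[mu]_x g x.
Proof.
move=> mf fg ig; have jf := dominated_integrable mf fg ig.
apply: (le_trans (le_normr_Rintegral measurableT jf)).
apply: le_Rintegral => //.
by apply: (@dominated_integrable _ g) => //; [exact: measurableT_comp|move=> x; rewrite normr_id].
Qed.

Lemma Rintegral_dominated_cvg (f_ : nat -> T -> R) f g :
  (forall n, measurable_fun setT (f_ n)) -> measurable_fun setT f ->
  (forall x, f_ n x @[n --> \oo] --> f x) ->
  mu.-integrable setT (EFin \o g) -> (forall n x, `|f_ n x| <= g x) ->
  (\int[mu]_x f_ n x) @[n --> \oo] --> \int[mu]_x f x.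
Proof.
move=> mf_ mf ff ig fg.
have mfe_ n : measurable_fun setT (EFin \o f_ n) by exact/measurable_EFinP.
have mfe : measurable_fun setT (EFin \o f) by exact/measurable_EFinP.
have [|| jf _ h] := @dominated_convergence _ _ _ mu setT measurableT
  (fun n => EFin \o f_ n) (EFin \o f) (EFin \o g) mfe_ mfe _ ig.
- by apply: aeW => x _; apply: cvg_EFin; [exact: nearW|exact: ff].
- by apply: aeW => x n _ /=; rewrite lee_fin.
- apply: fine_cvg; rewrite fineK; last exact: integrable_fin_num.
  exact: h.
Qed.
End Measure.

Section Probability.
Context d (T : measurableType d) (R : realType) (P : probability T R).
Implicit Types f g : T -> R.

Lemma integrable_cst_prob (k : R) : P.-integrable setT (EFin \o (fun=> k)).
Proof. by apply: finite_measure_integrable_cst. Qed.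

Lemma Rintegral_cst_prob (k : R) : \int[P]_x k = k.
Proof. by rewrite Rintegral_cst// [X in fine X](probability_setT P) mulr1. Qed.

Lemma integrable_bounded f (M : R) : measurable_fun setT f ->
  (forall x, `|f x| <= M) -> P.-integrable setT (EFin \o f).
Proof. by move=> mf fM; exact: (dominated_integrable mf fM (integrable_cst_prob M)). Qed.
End Probability.

Lemma Fubini_bounded d1 d2 (T1 : measurableType d1) (T2 : measurableType d2)
    (R : realType) (P1 : probability T1 R) (P2 : probability T2 R)
    (f : T1 -> T2 -> R) (M : R) :
  measurable_fun setT (fun z : T1 * T2 => f z.1 z.2) ->
  (forall x y, `|f x y| <= M) ->
  \int[P1]_x \int[P2]_y f x y = \int[P2]_y \int[P1]_x f x y.
Proof.
move=> mf fM.
have i12 : (P1 \x P2)%E.-integrable setT (EFin \o (fun z : T1 * T2 => f z.1 z.2)).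
  by apply: (@integrable_bounded _ _ _ (P1 \x P2)%E _ M) => // -[x y]; exact: fM.
have i1 x : P2.-integrable setT (EFin \o f x).
  by apply: (@integrable_bounded _ _ _ _ _ M) => //; exact: (measurableT_comp mf (pair1_measurable x)).
have i2 y : P1.-integrable setT (EFin \o f^~ y).
  by apply: (@integrable_bounded _ _ _ _ _ M) => //; exact: (measurableT_comp mf (pair2_measurable y)).
have := Fubini i12; rewrite /= => F.
rewrite /Rintegral; congr fine; rewrite -[RHS](_ : (\int[P2]_y \int[P1]_x (f x y)%:E = _)%E).
  rewrite -[RHS]F; apply: eq_integral => x _; rewrite fineK//.
  exact: integrable_fin_num (i1 x).
by apply: eq_integral => y _; rewrite fineK//; exact: integrable_fin_num (i2 y).
Qed.

(** * Integration against a normal law *)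

Section Normal.
Context (R : realType).
Notation leb := (@lebesgue_measure R).

(** The density of a normal law is its Radon-Nikodym derivative, by uniqueness
    of the latter up to Lebesgue-null sets. *)
Lemma ge0_integral_normal (m s : R) (f : R -> \bar R) :
  measurable_fun setT f -> (forall x, 0 <= f x)%E ->
  (\int[normal_prob m s]_x f x = \int[leb]_x (f x * (normal_pdf m s x)%:E))%E.
Proof.
move=> mf f0; have dom := normal_prob_dominates m s.
rewrite -(Radon_Nikodym_SigmaFinite.change_of_variables dom)//.
apply: ae_eq_integral => //.
- apply: emeasurable_funM => //; apply: (measurable_int leb).
  exact: Radon_Nikodym_SigmaFinite.f_integrable.
- apply: emeasurable_funM => //; apply/measurable_EFinP.
  exact: measurable_normal_pdf.
- apply: ae_eqe_mul2l => /=; apply: integral_ae_eq => //.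
  + exact: Radon_Nikodym_SigmaFinite.f_integrable.
  + by apply/measurable_EFinP; exact: measurable_normal_pdf.
  + by move=> E E01 mE; rewrite -Radon_Nikodym_SigmaFinite.f_integral.
Qed.

Lemma integrable_normal (m s : R) (f : R -> R) :
  measurable_fun setT f ->
  leb.-integrable setT (EFin \o (fun x => f x * normal_pdf m s x)) ->
  (normal_prob m s).-integrable setT (EFin \o f).
Proof.
move=> mf /integrableP[_ fi]; apply/integrableP; split; first exact/measurable_EFinP.
rewrite ge0_integral_normal//; last by apply: measurableT_comp => //; exact/measurable_EFinP.
apply: le_lt_trans fi; rewrite le_eqVlt; apply/orP; left; apply/eqP.
by apply: eq_integral => x _ /=; rewrite normrM (ger0_norm (normal_pdf_ge0 _ _ _)).
Qed.

Lemma Rintegral_normal (m s : R) (f : R -> R) :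
  measurable_fun setT f ->
  leb.-integrable setT (EFin \o (fun x => f x * normal_pdf m s x)) ->
  \int[normal_prob m s]_x f x = \int[leb]_x (f x * normal_pdf m s x).
Proof.
move=> mf fi; have dom := normal_prob_dominates m s.
have fn := integrable_normal mf fi.
rewrite /Rintegral; congr fine.
rewrite -(Radon_Nikodym_change_of_variables dom measurableT fn)/=.
under [in RHS]eq_integral do rewrite EFinM.
apply: ae_eq_integral => //.
- apply: emeasurable_funM; first exact/measurable_EFinP.
  apply: (measurable_int leb).
  by apply: Radon_Nikodym_integrable; exact: dom.
- apply: emeasurable_funM; first exact/measurable_EFinP.
  by apply/measurable_EFinP; exact: measurable_normal_pdf.
- apply: ae_eqe_mul2l => /=; rewrite Radon_NikodymE//=.
  case: cid => /= h [h1 h2 h3].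
  apply: integral_ae_eq => //=.
  + by apply/measurable_EFinP; exact: measurable_normal_pdf.
  + by move=> E E01 mE; rewrite -h3.
Qed.


Lemma pow4_le_expR (t : R) : 0 <= t -> t ^+ 4 <= 4 ^+ 4 * expR t.
Proof.
move=> t0; have e := expR_ge1Dx (t / 4).
have -> : expR t = expR (t / 4) ^+ 4 by rewrite -expRM_natl; congr expR; field.
rewrite (_ : t ^+ 4 = 4 ^+ 4 * (t / 4) ^+ 4); last by field.
by rewrite ler_pM2l ?exprn_gt0// lerXn2r ?nnegrE ?expR_ge0//; lra.
Qed.

(** Half of the exponent is spent on absorbing the polynomial; what remains is
    the density with the larger deviation [s * sqrt 2], which is again
    integrable. *)
Lemma normal_fun_growth (m s : R) : s != 0 -> exists2 K : R, 0 <= K &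
  forall x, (1 + (x - m) ^+ 8) * normal_fun m s x <=
            K * normal_fun m (s * Num.sqrt 2) x.
Proof.
move=> s0; have s2 : 0 < s ^+ 2 by rewrite exprn_even_gt0.
exists (1 + 4 ^+ 4 * (4 * s ^+ 2) ^+ 4).
  by rewrite addr_ge0// mulr_ge0// ?exprn_ge0// mulr_ge0// ltW.
move=> x; pose t := (x - m) ^+ 2 / (4 * s ^+ 2).
have t0 : 0 <= t by rewrite divr_ge0 ?sqr_ge0// mulr_ge0// ltW.
have -> : normal_fun m s x = expR (- t) * expR (- t).
  rewrite -expRD /normal_fun; congr expR; rewrite /t; field; exact: s0.
have -> : normal_fun m (s * Num.sqrt 2) x = expR (- t).
  by rewrite /normal_fun; congr expR; rewrite exprMn sqr_sqrtr// /t; field; exact: s0.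
rewrite mulrA ler_pM2r ?expR_gt0//.
have -> : (x - m) ^+ 8 = (4 * s ^+ 2) ^+ 4 * t ^+ 4.
  rewrite /t; field; exact: s0.
have /(ler_wpM2r (expR_ge0 (- t))) := pow4_le_expR t0.
rewrite -(mulrA (4 ^+ 4)) -expRD subrr expR0 mulr1 => h.
rewrite mulrDl mul1r lerD//; first by rewrite -expR0 ler_expR oppr_le0.
by rewrite -mulrA [leRHS]mulrC ler_wpM2l// exprn_ge0// mulr_ge0// ltW.
Qed.

Lemma growth_integrable (m s C : R) (f : R -> R) : s != 0 ->
  measurable_fun setT f -> (forall x, `|f x| <= C * (1 + (x - m) ^+ 8)) ->
  leb.-integrable setT (EFin \o (fun x => f x * normal_pdf m s x)).
Proof.
move=> s0 mf fC; have [K K0 HK] := normal_fun_growth m s0.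
have C0 : 0 <= C.
  have := le_trans (normr_ge0 _) (fC m); by rewrite subrr expr0n addr0 mulr1.
have s20 : s * Num.sqrt 2 != 0 by rewrite mulf_neq0// gt_eqF// sqrtr_gt0.
have p0 : 0 < normal_peak (s * Num.sqrt 2) by exact: normal_peak_gt0.
apply: (dominated_integrable (mu := leb) 
  (g := fun x => (C * normal_peak s * K / normal_peak (s * Num.sqrt 2)) *
   normal_pdf m (s * Num.sqrt 2) x)).
- by apply: measurable_funM => //; exact: measurable_normal_pdf.
- move=> x; rewrite normrM (ger0_norm (normal_pdf_ge0 _ _ _)).
  rewrite !normal_pdfE//; set p := normal_peak (s * _) in p0 *.
  have -> a b : a / p * (p * b) = a * b by field; rewrite gt_eqF.
  apply: (@le_trans _ _ (C * (1 + (x - m) ^+ 8) * (normal_peak s * normal_fun m s x))).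
    by apply: ler_wpM2r => //; rewrite mulr_ge0 ?normal_peak_ge0 ?normal_fun_ge0.
  have := ler_wpM2l (mulr_ge0 C0 (normal_peak_ge0 s)) (HK x).
  by congr (_ <= _); ring.
- exact/integrableZ_EFin/integrable_normal_pdf.
Qed.

(** Degree 8 covers the sixth powers behind the third moment of a sum of
    Gaussian squares, and the extra factor [x - m] in the integration by parts
    below. *)
Lemma growth_normal (m s C : R) (f : R -> R) : s != 0 ->
  measurable_fun setT f -> (forall x, `|f x| <= C * (1 + (x - m) ^+ 8)) ->
  (normal_prob m s).-integrable setT (EFin \o f) /\
  \int[normal_prob m s]_x f x = \int[leb]_x (f x * normal_pdf m s x).
Proof.
move=> s0 mf fC; have fi := growth_integrable s0 mf fC.
by split; [exact: integrable_normal|exact: Rintegral_normal].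
Qed.
End Normal.

(** * Integration by parts for a normal law *)

Section IBP.
Context (R : realType).
Notation leb := (@lebesgue_measure R).

Lemma cvg_Rintegral_itv (k : R -> R) (m : R) :
  leb.-integrable setT (EFin \o k) ->
  (\int[leb]_(x in `[m - n.+1%:R, m + n.+1%:R]) k x) @[n --> \oo] --> \int[leb]_x k x.
Proof.
move=> ik; have mk : measurable_fun setT k by apply/measurable_EFinP; exact: measurable_int ik.
under eq_fun do rewrite Rintegral_mkcond.
apply: (@Rintegral_dominated_cvg _ _ _ leb (fun n => k \_ `[m - n.+1%:R, m + n.+1%:R]) k (fun x => `|k x|)) => //.
- by move=> n; apply/(measurable_restrictT _ _).1 => //; exact: measurable_funTS.
- move=> x; apply: cvg_near_cst; near=> n; rewrite patchE ifT// inE/= in_itv/=.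
  suff : `|x - m| <= n%:R.
    by rewrite ler_norml -natr1 => /andP[? ?]; apply/andP; split; lra.
  near: n; exact: nbhs_infty_ger.
- exact: integrable_norm.
- by move=> n x; rewrite patchE; case: ifP => //; rewrite normr0.
Unshelve. all: by end_near. Qed.

Lemma is_derive_continuous (F f : R -> R) :
  (forall x, is_derive x (1 : R) F (f x)) -> continuous F.
Proof.
move=> dF x; apply: differentiable_continuous; apply/derivable1_diffP.
exact: (@ex_derive _ _ _ _ _ _ _ (dF x)).
Qed.

Lemma Rintegral_FTC (F f : R -> R) (a b : R) : a < b ->
  (forall x, is_derive x (1 : R) F (f x)) -> continuous f ->
  \int[leb]_(x in `[a, b]) f x = F b - F a.
Proof.
move=> ab dF cf; have cF := is_derive_continuous dF.
rewrite /Rintegral (@continuous_FTC2 _ f F)//.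
- exact: continuous_subspaceT.
- split.
  + by move=> x _; exact: (@ex_derive _ _ _ _ _ _ _ (dF x)).
  + by apply: cvg_at_right_filter; exact: cF.
  + by apply: cvg_at_left_filter; exact: cF.
- by move=> x _; rewrite derive1E; exact: (@derive_val _ _ _ _ _ _ _ (dF x)).
Qed.

Lemma is_derive_normal_pdf (m s x : R) : s != 0 ->
  is_derive x (1 : R) (normal_pdf m s) (- (x - m) / s ^+ 2 * normal_pdf m s x).
Proof.
move=> s0.
have -> : normal_pdf m s = (fun x => normal_peak s * expR ((- (s ^+ 2 *+ 2)^-1) * (x - m) ^+ 2)).
  by rewrite normal_pdfE//; apply/funext => y; rewrite /normal_fun; congr (_ * expR _); field.
apply: is_derive_eq; rewrite /GRing.scale /=.
by rewrite -mulr_natl; field.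
Qed.

(** The integrand times the density is the derivative of
    [s ^+ 2 * G * normal_pdf m s], so its integral over [[m - n, m + n]] is a
    boundary term, which is O(1/n) by the growth condition.  Mean, moments and
    cosine transform all come from this identity. *)
Lemma normal_IBP (m s C : R) (G g : R -> R) : s != 0 ->
  (forall x, is_derive x (1 : R) G (g x)) -> continuous g ->
  (forall x, `|G x| <= C * (1 + (x - m) ^+ 6)) ->
  (forall x, `|g x| <= C * (1 + (x - m) ^+ 6)) ->
  \int[normal_prob m s]_x (s ^+ 2 * g x - (x - m) * G x) = 0.
Proof.
move=> s0 dG cg GC gC; have cG := is_derive_continuous dG.
have s2 : 0 < s ^+ 2 by rewrite exprn_even_gt0.
have C0 : 0 <= C.
  have := le_trans (normr_ge0 _) (GC m); by rewrite subrr expr0n addr0 mulr1.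
have y6 (y : R) : 1 + y ^+ 6 <= 2 * (1 + y ^+ 8).
  have : 0 <= y ^+ 2 by exact: sqr_ge0.
  by rewrite (exprM y 2 3) (exprM y 2 4); move: (y ^+ 2) => z z0; nra.
have y7 (y : R) : `|y| * (1 + y ^+ 6) <= 3 * (1 + y ^+ 8).
  have := sqr_ge0 y; have := sqr_ge0 (`|y| - 1); rewrite sqrrB1 real_normK ?num_real//.
  rewrite (exprM y 2 3) (exprM y 2 4); move: (y ^+ 2) `|y| => z w hw z0.
  have h1 := sqr_ge0 (z - 1); have h2 := sqr_ge0 (z ^+ 2 - 1); have h3 := sqr_ge0 (z * (z - 1)).
  apply: (@le_trans _ _ ((z + 1) / 2 * (1 + z ^+ 3))); last by nra.
  by rewrite ler_wpM2r ?addr_ge0 ?exprn_ge0//; lra.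
pose k x := s ^+ 2 * g x - (x - m) * G x.
have ck : continuous k.
  move=> x; apply: cvgB; apply: cvgM; [exact: cvg_cst|exact: cg| |exact: cG].
  by apply: cvgB; [exact: cvg_id|exact: cvg_cst].
have mk : measurable_fun setT k by exact: continuous_measurable_fun.
have yG x : `|x - m| * (C * (1 + (x - m) ^+ 6)) <= 3 * C * (1 + (x - m) ^+ 8).
  by have := ler_wpM2l C0 (y7 (x - m)); congr (_ <= _); ring.
have kC x : `|k x| <= (2 * s ^+ 2 * C + 3 * C) * (1 + (x - m) ^+ 8).
  rewrite (le_trans (ler_normB _ _))// normrM (gtr0_norm s2) [X in _ + X <= _]normrM mulrDl lerD//.
    apply: (le_trans (ler_wpM2l (ltW s2) (gC x))).
    by have := ler_wpM2l (mulr_ge0 (ltW s2) C0) (y6 (x - m)); congr (_ <= _); ring.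
  by rewrite (le_trans (ler_wpM2l _ (GC x))).
have [_ ->] := growth_normal s0 mk kC.
have ik := growth_integrable s0 mk kC.
pose K x := s ^+ 2 * (G x * normal_pdf m s x).
have dK x : is_derive x (1 : R) K (k x * normal_pdf m s x).
  have dp := is_derive_normal_pdf m x s0; have dGx := dG x.
  apply: is_derive_eq; rewrite /GRing.scale /= /k.
  by field.
have cp := @continuous_normal_pdf R m s s0.
have ckp : continuous (fun x => k x * normal_pdf m s x).
  by move=> x; apply: cvgM; [exact: ck|exact: cp].
have [K0 K00 HK] := normal_fun_growth m s0.
have KM x : `|x - m| * `|K x| <= s ^+ 2 * (3 * C * (normal_peak s * K0)).
  rewrite /K normrM (gtr0_norm s2) normrM (ger0_norm (normal_pdf_ge0 _ _ _)) mulrCA ler_pM2l//.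
  rewrite mulrA; apply: (@le_trans _ _ (3 * C * (1 + (x - m) ^+ 8) * normal_pdf m s x)).
    apply: ler_wpM2r; first exact: normal_pdf_ge0.
    by rewrite (le_trans (ler_wpM2l _ (GC x))).
  rewrite -mulrA ler_wpM2l// ?mulr_ge0// normal_pdfE// mulrCA ler_wpM2l ?normal_peak_ge0//.
  rewrite (le_trans (HK x))// ler_piMr// /normal_fun -expR0 ler_expR mulNr oppr_le0.
  by rewrite divr_ge0 ?sqr_ge0// mulrn_wge0// sqr_ge0.
set M := s ^+ 2 * _ in KM.
apply: (cvg_unique _ (cvg_Rintegral_itv m ik)) => //.
apply/cvgr0Pnorm_le => e e0; near=> n.
rewrite (@Rintegral_FTC K)//; last by rewrite ltrD2l gtrN// ltr0n.
have Kn b : `|b - m| = n.+1%:R -> `|K b| <= M / n.+1%:R.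
  by move=> bm; rewrite ler_pdivlMr ?ltr0n// mulrC -bm.
rewrite (le_trans (ler_normB _ _))//.
have h1 : `|m + n.+1%:R - m| = n.+1%:R by rewrite addrAC subrr add0r normr_nat.
have h2 : `|m - n.+1%:R - m| = n.+1%:R by rewrite addrAC subrr add0r normrN normr_nat.
rewrite (le_trans (lerD (Kn _ h1) (Kn _ h2)))//.
rewrite -mulrDl ler_pdivrMr ?ltr0n// mulrC -ler_pdivrMr//.
rewrite (@le_trans _ _ n%:R) ?ler_nat//; near: n; exact: nbhs_infty_ger.
Unshelve. all: by end_near. Qed.
End IBP.

(** * Moments and transforms of a normal law *)

Section NormalFacts.
Context (R : realType).
Implicit Types m s t b x : R.

Lemma norm_exprn_le_even (x : R) (k N : nat) : ~~ odd N -> (k <= N)%N ->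
  `|x ^+ k| <= 1 + x ^+ N.
Proof.
move=> evN kN; have -> : x ^+ N = `|x| ^+ N by rewrite -normrX ger0_norm// exprn_even_ge0.
rewrite normrX; have [x1|x1] := leP `|x| 1.
  by rewrite (le_trans (exprn_ile1 _ _ x1))// lerDl exprn_ge0.
by rewrite (le_trans (ler_weXn2l (ltW x1) kN))// lerDr.
Qed.

Lemma norm_le_growth (m x : R) : `|x| <= (1 + `|m|) * (1 + (x - m) ^+ 8).
Proof.
have := norm_exprn_le_even (x - m) (isT : ~~ odd 8) (isT : 1 <= 8)%N; rewrite expr1 => h.
rewrite -{1}(subrK m x) (le_trans (ler_normD _ _))// mulrDl mul1r lerD//.
by rewrite ler_peMr// lerDl exprn_even_ge0.
Qed.

Lemma normal_pow_integrable s k : s != 0 -> (k <= 8)%N ->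
  (normal_prob 0 s).-integrable setT (EFin \o (fun x => x ^+ k)).
Proof.
move=> s0 k8; apply: (growth_normal (C := 1) s0 _ _).1 => [|x].
  exact: measurable_funX.
by rewrite subr0 mul1r; exact: norm_exprn_le_even.
Qed.

Lemma normal_mean m s : s != 0 -> \int[normal_prob m s]_x x = m.
Proof.
move=> s0.
have : \int[normal_prob m s]_x (s ^+ 2 * 0 - (x - m) * 1) = 0.
  apply: (@normal_IBP R m s 1 (cst 1) (cst 0)) => // x; first exact: cvg_cst.
    by rewrite mul1r normr1 lerDl exprn_even_ge0.
  by rewrite mul1r normr0 addr_ge0// exprn_even_ge0.
under eq_Rintegral do rewrite mulr0 mulr1 sub0r opprB -[X in m - X]mul1r.
have [] := @growth_normal R m s (1 + `|m|) id s0 _ _ => [|x|jf _].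
- exact: measurable_id.
- exact: norm_le_growth.
rewrite RintegralB//; [|exact: integrable_cst_prob|exact: integrableZ_EFin].
rewrite (Rintegral_cst_prob (normal_prob m s) m) RintegralZl//.
by rewrite mul1r => /eqP; rewrite subr_eq0 => /eqP /esym.
Qed.

Lemma normal_moment s k : s != 0 -> (k <= 5)%N ->
  \int[normal_prob 0 s]_x (x ^+ k.+2) =
  s ^+ 2 * (k.+1%:R * \int[normal_prob 0 s]_x (x ^+ k)).
Proof.
move=> s0 k5.
have k1 : 1 <= k.+1%:R :> R by rewrite ler1n.
have x6 x i : (i <= 6)%N -> `|x ^+ i| <= 1 + (x - 0) ^+ 6.
  by move=> i6; rewrite subr0; exact: norm_exprn_le_even.
have : \int[normal_prob 0 s]_x (s ^+ 2 * (k.+1%:R * x ^+ k) - (x - 0) * x ^+ k.+1) = 0.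
  apply: (@normal_IBP R 0 s k.+1%:R) => // [x|x|x|x].
  - have -> : (fun y : R => y ^+ k.+1) = (id : R -> R) ^+ k.+1.
      by apply/funext => y; rewrite fctE.
    by apply: is_derive_eq; rewrite /GRing.scale /= mulr1.
  - by apply: cvgM; [exact: cvg_cst|exact: exprn_continuous].
  - apply: (le_trans (x6 _ _ _)) => //.
    by rewrite ler_peMl// addr_ge0// exprn_even_ge0.
  - by rewrite normrM normr_nat ler_wpM2l// x6// (leq_trans k5).
under eq_Rintegral do rewrite subr0 -exprS.
have ik := normal_pow_integrable s0 (leq_trans k5 (isT : 5 <= 8)%N).
rewrite RintegralB//; first last.
- by apply: (normal_pow_integrable s0); exact: (leq_trans (k5 : (k.+2 <= 7)%N)).
- by do 2 apply: integrableZ_EFin.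
rewrite RintegralZl//; last exact: integrableZ_EFin.
by rewrite RintegralZl// => /eqP; rewrite subr_eq0 => /eqP ->.
Qed.

(** With [phi t] the left-hand side, differentiation under the integral and
    integration by parts give [phi' t = - s ^+ 2 * t * phi t], and
    [phi 0 = cos b].  Keeping the phase [b] makes sines superfluous. *)
Lemma normal_cos s t b : s != 0 ->
  \int[normal_prob 0 s]_x cos (t * x + b) = cos b * expR (- (s ^+ 2 * t ^+ 2 / 2)).
Proof.
move=> s0; set g := normal_prob 0 s.
have ccos u : continuous (fun x => cos (u * x + b)).
  move=> x; apply: continuous_comp; last exact: continuous_cos.
  by apply: cvgD; [apply: cvgM; [exact: cvg_cst|exact: cvg_id]|exact: cvg_cst].
have csin u : continuous (fun x => sin (u * x + b)).
  move=> x; apply: continuous_comp; last exact: continuous_sin.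
  by apply: cvgD; [apply: cvgM; [exact: cvg_cst|exact: cvg_id]|exact: cvg_cst].
have cos1 (y : R) : `|cos y| <= 1 by rewrite ler_norml cos_geN1 cos_le1.
have sin1 (y : R) : `|sin y| <= 1 by rewrite ler_norml sin_geN1 sin_le1.
have mcos u : measurable_fun setT (fun x => cos (u * x + b)) by exact: continuous_measurable_fun.
have msin u : measurable_fun setT (fun x => sin (u * x + b)) by exact: continuous_measurable_fun.
pose phi u := \int[g]_x cos (u * x + b).
have dcos u x : is_derive u (1 : R) (fun v => cos (v * x + b)) (- x * sin (u * x + b)).
  by apply: is_derive_eq; rewrite /GRing.scale /=; ring.
have ix : g.-integrable setT (EFin \o (fun x => `|x|)).
  apply: (growth_normal (C := 1) s0 _ _).1.
    by apply: measurableT_comp.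
  move=> x; rewrite normr_id subr0 mul1r.
  by have := norm_exprn_le_even x (isT : ~~ odd 8) (isT : 1 <= 8)%N; rewrite expr1.
have dphi u : is_derive u (1 : R) phi (- (s ^+ 2 * u) * phi u).
  have uI : `]u - 1, u + 1[%classic u by rewrite /= in_itv/=; apply/andP; split; lra.
  have intf v : `]u - 1, u + 1[%classic v -> g.-integrable setT (EFin \o (fun x => cos (v * x + b))).
    by move=> _; apply: (@integrable_bounded _ _ _ _ _ 1) => [|x]; [exact: mcos|exact: cos1].
  have derf v x : `]u - 1, u + 1[%classic v -> setT x -> derivable ((fun v x => cos (v * x + b)) ^~ x) v 1.
    by move=> _ _; exact: (@ex_derive _ _ _ _ _ _ _ (dcos v x)).
  have p1 v x : partial1of2 (fun v x => cos (v * x + b)) v x = - x * sin (v * x + b).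
    by rewrite partial1of2E; exact: (@derive_val _ _ _ _ _ _ _ (dcos v x)).
  have ub v x : `]u - 1, u + 1[%classic v -> setT x ->
     `|partial1of2 (fun v x => cos (v * x + b)) v x| <= `|x|.
    by move=> _ _; rewrite p1 normrM normrN ler_piMr.
  have nn (y : R) : 0 <= `|y| by [].
  have D1 := derivable_under_integral measurableT uI intf derf nn ix ub.
  have D2 := differentiation_under_integral measurableT uI intf derf nn ix ub.
  apply: DeriveDef; first exact: D1.
  rewrite -derive1E D2.
  under eq_Rintegral do rewrite p1.
  have isin : g.-integrable setT (EFin \o (fun x => x * sin (u * x + b))).
    apply: dominated_integrable ix; first by apply: measurable_funM; [exact: measurable_id|exact: msin].
    by move=> x; rewrite normrM ler_piMr.
  have icos : g.-integrable setT (EFin \o (fun x => u * cos (u * x + b))).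
    by apply: integrableZ_EFin; apply: intf.
  have x6 x : 1 <= 1 + (x - 0) ^+ 6 by rewrite lerDl exprn_even_ge0.
  have : \int[g]_x (s ^+ 2 * (u * cos (u * x + b)) - (x - 0) * sin (u * x + b)) = 0.
    apply: (@normal_IBP R 0 s (1 + `|u|)) => // [x|x|x|x].
    - by apply: is_derive_eq; rewrite /GRing.scale /=; ring.
    - by apply: cvgM; [exact: cvg_cst|exact: ccos].
    - by apply: (le_trans (sin1 _)); rewrite -[leLHS]mul1r ler_pM// lerDl.
    - rewrite normrM ler_pM//; first by rewrite lerDr.
      exact: (le_trans (cos1 _)).
  under eq_Rintegral do rewrite subr0.
  rewrite RintegralB//; last exact: integrableZ_EFin.
  rewrite RintegralZl// RintegralZl//; last exact: intf.
  move=> /eqP; rewrite subr_eq0 => /eqP E.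
  under eq_Rintegral do rewrite mulNr -mulN1r.
  rewrite RintegralZl// -E /phi; ring.
have cst u : is_derive u (1 : R) (fun u => phi u * expR (s ^+ 2 / 2 * u ^+ 2)) 0.
  have := dphi u => H.
  by apply: is_derive_eq; rewrite /GRing.scale /=; field.
have := is_derive_0_is_cst t 0 cst.
rewrite expr0n mulr0 expR0 mulr1 {2}/phi.
under [X in _ = X -> _]eq_Rintegral do rewrite mul0r add0r.
rewrite Rintegral_cst_prob => H.
rewrite -H -/(phi t) -(mulrA (phi t)) -expRD (_ : _ + _ = 0) ?expR0 ?mulr1//.
by field.
Qed.

(** The integrand is, up to a constant factor, the density of a normal law of
    variance [(1 + 2 * c)^-1]. *)
Lemma normal_exp_sqr (c : R) : 0 <= c ->
  \int[normal_prob 0 1]_x expR (- (c * x ^+ 2)) = (Num.sqrt (1 + 2 * c))^-1.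
Proof.
move=> c0; have c1 : 0 < 1 + 2 * c by lra.
pose s : R := (Num.sqrt (1 + 2 * c))^-1.
have s0 : s != 0 by rewrite invr_eq0 gt_eqF// sqrtr_gt0.
have s2 : s ^+ 2 = (1 + 2 * c)^-1 by rewrite exprVn sqr_sqrtr// ltW.
have -> : \int[normal_prob 0 1]_x expR (- (c * x ^+ 2)) =
    \int[lebesgue_measure]_x (expR (- (c * x ^+ 2)) * normal_pdf 0 1 x).
  apply: (growth_normal (C := 1) (oner_neq0 R) _ _).2 => [|x].
    apply: continuous_measurable_fun => x.
    apply: continuous_comp; last exact: continuous_expR.
    by apply: cvgN; apply: cvgM; [exact: cvg_cst|exact: exprn_continuous].
  rewrite ger0_norm ?expR_ge0// mul1r subr0 (@le_trans _ _ 1)//.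
    by rewrite -expR0 ler_expR oppr_le0 mulr_ge0// sqr_ge0.
  by rewrite lerDl exprn_even_ge0.
have -> : (fun x => expR (- (c * x ^+ 2)) * normal_pdf 0 1 x) = (fun x => s * normal_pdf 0 s x).
  apply/funext => x; rewrite !normal_pdfE ?oner_neq0// /normal_peak /normal_fun s2.
  have -> : - (x - 0) ^+ 2 / ((1 + 2 * c)^-1 *+ 2) =
            - (c * x ^+ 2) + - (x - 0) ^+ 2 / (1 ^+ 2 *+ 2).
    by field; rewrite gt_eqF.
  have -> : (Num.sqrt ((1 + 2 * c)^-1 * pi *+ 2))^-1 = s^-1 / Num.sqrt (1 ^+ 2 * pi *+ 2).
    rewrite expr1n mul1r -mulrnAr sqrtrM ?invr_ge0 ?ltW// sqrtrV ?ltW//.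
    by rewrite invfM.
  by rewrite expRD; field; rewrite s0/= gt_eqF// sqrtr_gt0 expr1n mul1r mulrn_wgt0// pi_gt0.
rewrite RintegralZl//; last exact: integrable_normal_pdf.
by rewrite /Rintegral integral_normal_pdf mulr1.
Qed.

End NormalFacts.

(** * Centred Gaussian random variables *)

Section GaussRV.
Context (R : realType) (d : measure_display) (Omega : measurableType d) (P : probability Omega R).

Lemma law_transfer (Z : {RV P >-> R}) (nu : probability (measurableTypeR R) R) (f : R -> R) :
  (forall B : set (measurableTypeR R), measurable B -> distribution P Z B = nu B) ->
  measurable_fun setT f -> nu.-integrable setT (EFin \o f) ->
  P.-integrable setT (EFin \o (fun w => f (Z w))) /\
  \int[P]_w f (Z w) = \int[nu]_x f x.
Proof.
move=> Znu mf fi.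
have mfe : measurable_fun setT (EFin \o f) by exact/measurable_EFinP.
have mfZ : measurable_fun setT (fun w => f (Z w)) by exact: measurableT_comp.
(* The law of Z and nu live on the same sigma-algebra under two displays;
   Z is retyped so that its law lives where nu does. *)
have mZ : measurable_fun setT (Z : Omega -> measurableTypeR R) by have := measurable_funPT Z; exact.
pose Z' : {mfun Omega >-> measurableTypeR R} :=
  MeasurableFun.Pack (MeasurableFun.Class (isMeasurableFun.Build _ _ _ _ _ mZ)).
have law (h : R -> \bar R) : (\int[distribution P Z']_x h x = \int[nu]_x h x)%E.
  by apply: (eq_measure_integral nu) => A mA _; exact: Znu.
have i : P.-integrable setT (EFin \o (fun w => f (Z w))).
  apply/integrableP; split; first exact/measurable_EFinP.
  move/integrableP : fi => [_]; apply: le_lt_trans.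
  rewrite -(law (fun x => `|(f x)%:E|)%E).
  rewrite (@ge0_integral_distribution _ _ _ _ _ P Z')//; last exact: measurableT_comp.
split=> //; rewrite /Rintegral; congr fine.
by rewrite -(law (EFin \o f)) (@integral_distribution _ _ _ _ _ P Z').
Qed.

(** What the proof uses of a centred Gaussian law of variance [v]; the form is
    the same for a point mass, where [v = 0].  The cosine transform with an
    arbitrary phase stands for the characteristic function. *)
Definition centred_gaussian (Z : Omega -> R) (v : R) := [/\ 0 <= v,
  forall b, \int[P]_w cos (Z w + b) = cos b * expR (- (v / 2)),
  forall k, (k <= 8)%N -> P.-integrable setT (EFin \o (fun w => Z w ^+ k)),
  \int[P]_w (Z w ^+ 2) = v & \int[P]_w (Z w ^+ 4) = 3 * v ^+ 2].

(** A Gaussian law is either a point mass or a normal law; in both cases the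
    zero mean forces its centre to be 0. *)
Lemma gaussian_rv_centred_gaussian (Z : {RV P >-> R}) :
  gaussian_rv Z -> \int[P]_w Z w = 0 -> centred_gaussian Z (\int[P]_w (Z w ^+ 2)).
Proof.
move=> [m [s Zms]] Z0; have [s0|s0] := eqVneq s 0.
  have Zm f : measurable_fun setT f -> P.-integrable setT (EFin \o (fun w => f (Z w))) /\
      \int[P]_w f (Z w) = f m.
    move=> mf; have mfe : measurable_fun setT (EFin \o f) by exact/measurable_EFinP.
    have [||i ->] := @law_transfer Z (@dirac _ (measurableTypeR R) m R) f _ mf.
    - by move=> B mB; rewrite Zms// /gaussian_law s0 eqxx.
    - apply/integrableP; split => //; rewrite integral_dirac//; last exact: measurableT_comp.
      by rewrite diracT mul1e ltry.
    - split => //; rewrite /Rintegral integral_dirac// diracT mul1e//.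
  have m0 : m = 0 by rewrite -Z0; have [_ ->] := Zm id (@measurable_id _ _ _).
  have pw k : (0 < k)%N -> \int[P]_w (Z w ^+ k) = 0.
    by move=> k0; have [_ ->] := Zm (fun x => x ^+ k) (measurable_funX _ (@measurable_id _ _ _));
      rewrite m0 expr0n gtn_eqF.
  rewrite pw//; split => //.
  - move=> b; have [|_ ->] := Zm (fun x => cos (x + b)).
      apply: continuous_measurable_fun => x.
      by apply: continuous_comp; [apply: cvgD; [exact: cvg_id|exact: cvg_cst]|exact: continuous_cos].
    by rewrite m0 add0r mul0r oppr0 expR0 mulr1.
  - by move=> k _; have [] := Zm (fun x => x ^+ k) (measurable_funX _ (@measurable_id _ _ _)).
  - by rewrite pw.
  - by rewrite pw// expr0n mulr0.
have Znu B : measurable B -> distribution P Z B = normal_prob m s B.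
  by move=> mB; rewrite Zms// /gaussian_law (negbTE s0).
have mid : measurable_fun [set: R] (fun x : R => x) by exact: measurable_id.
have m0 : m = 0.
  have [|_ Zm] := law_transfer Znu mid; last by rewrite -Z0 Zm normal_mean.
  have [] // := @growth_normal R m s (1 + `|m|) id s0 _ _.
  by move=> x; exact: norm_le_growth.
rewrite m0 in Znu.
have pw k : (k <= 8)%N -> P.-integrable setT (EFin \o (fun w => Z w ^+ k)) /\
   \int[P]_w (Z w ^+ k) = \int[normal_prob 0 s]_x (x ^+ k).
  move=> k8; apply: (law_transfer (f := fun x => x ^+ k) Znu); first exact: measurable_funX.
  exact: normal_pow_integrable.
have Z2 : \int[P]_w (Z w ^+ 2) = s ^+ 2.
  by rewrite (pw 2%N isT).2 normal_moment// Rintegral_cst_prob !mulr1.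
rewrite Z2; split => //.
- exact: sqr_ge0.
- move=> b; have mc : measurable_fun setT (fun x : R => cos (x + b)).
    apply: continuous_measurable_fun => x.
    by apply: continuous_comp; [apply: cvgD; [exact: cvg_id|exact: cvg_cst]|exact: continuous_cos].
  have [|_ ->] := law_transfer Znu mc.
    by apply: (@integrable_bounded _ _ _ _ _ 1) => // x; rewrite ler_norml cos_geN1 cos_le1.
  under eq_Rintegral do rewrite -[x in x + b]mul1r.
  by rewrite normal_cos// expr1n mulr1.
- by move=> k /pw[].
- rewrite (pw 4%N isT).2 normal_moment// normal_moment// Rintegral_cst_prob.
  ring.
Qed.
End GaussRV.

(** * Laplace transform of the squares of an uncorrelated Gaussian vector *)

Section Laplace.
Context (R : realType) (d : measure_display) (Omega : measurableType d) (P : probability Omega R).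
Variables (n : nat) (U : 'I_n -> Omega -> R) (l : 'I_n -> R).
Hypothesis mU : forall j, measurable_fun setT (U j).
Hypothesis gaussU : forall a : 'I_n -> R,
  centred_gaussian P (fun w => \sum_j a j * U j w) (\sum_j a j ^+ 2 * l j).

Lemma coord_variance_ge0 j : 0 <= l j.
Proof.
have [+ _ _ _ _] := gaussU (fun i => (i == j)%:R).
rewrite (bigD1 j)//= big1 => [|i ij].
  by rewrite eqxx expr1n mul1r addr0.
by rewrite (negbTE ij) expr0n mul0r.
Qed.

(** The average of [expR (- (v * a ^+ 2 / 2))], the Gaussian cosine transform
    at [a], over a normal perturbation of [a] of variance [2 * s]. *)
Definition smoothed_transform (s a v : R) : R :=
  \int[normal_prob 0 1]_g expR (- (v * (a + Num.sqrt (2 * s) * g) ^+ 2 / 2)).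

Lemma smoothed_transform0 s v : 0 <= s -> 0 <= v ->
  smoothed_transform s 0 v = (Num.sqrt (1 + 2 * (s * v)))^-1.
Proof.
move=> s0 v0; rewrite -normal_exp_sqr ?mulr_ge0//; apply: eq_Rintegral => g _.
by congr expR; rewrite add0r exprMn sqr_sqrtr ?mulr_ge0//; field.
Qed.

(** Linearization of squares: [expR (- (s * u ^+ 2))] is the average of
    [cos (sqrt (2 * s) * u * g)] over a standard normal [g].  Introducing the
    squares one coordinate at a time and exchanging the integrals, each step
    averages the coefficient of one coordinate in the linear form under the
    cosine.  The joint law of the coordinates is thereby only tested on linear
    forms, which is all that is known about a Gaussian vector. *)
Lemma mixed_transform (s : 'I_n -> R) : (forall j, 0 <= s j) ->
  forall (r : seq 'I_n), uniq r -> forall a : 'I_n -> R,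
  \int[P]_w (expR (- \sum_(j <- r) s j * U j w ^+ 2) * cos (\sum_j a j * U j w)) =
  \prod_j (if j \in r then smoothed_transform (s j) (a j) (l j) else expR (- (l j * a j ^+ 2 / 2))).
Proof.
move=> s0; elim=> [|k r IH] /=.
  move=> _ a; under eq_Rintegral do rewrite big_nil oppr0 expR0 mul1r.
  have [_ /(_ 0) + _ _ _] := gaussU a.
  under eq_Rintegral do rewrite addr0.
  rewrite cos0 mul1r => ->.
  rewrite -expR_sum; congr expR; rewrite sumrN mulr_suml; congr (- _).
  by apply: eq_bigr => j _; rewrite [_ * l j]mulrC.
move=> /andP[kr ur] a.
pose c := Num.sqrt (2 * s k).
have c2 : c ^+ 2 = 2 * s k by rewrite sqr_sqrtr// mulr_ge0.
pose a' g := fun j => a j + (j == k)%:R * (c * g).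
have sa' g w : \sum_j a' g j * U j w = c * U k w * g + \sum_j a j * U j w.
  rewrite /a'; under eq_bigr do rewrite mulrDl.
  rewrite big_split /= addrC; congr (_ + _).
  rewrite (bigD1 k)//= big1 ?eqxx ?mul1r ?addr0; first by ring.
  by move=> i ik; rewrite (negbTE ik) !mul0r.
have mS : measurable_fun setT (fun w => expR (- \sum_(j <- r) s j * U j w ^+ 2)).
  apply: measurableT_comp => //; apply: measurableT_comp => //.
  apply: measurable_sum => j; apply: measurable_funM => //.
  exact: measurable_funX.
transitivity (\int[P]_w \int[normal_prob 0 1]_g
   (expR (- \sum_(j <- r) s j * U j w ^+ 2) * cos (\sum_j a' g j * U j w))).
  apply: eq_Rintegral => w _; under eq_Rintegral do rewrite sa'.
  rewrite RintegralZl//; last first.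
    apply: (@integrable_bounded _ _ _ _ _ 1) => [|x]; last by rewrite ler_norml cos_geN1 cos_le1.
    apply: measurableT_comp; first exact: (continuous_measurable_fun (@continuous_cos R)).
    by apply: measurable_funD => //; apply: measurable_funM => //; exact: measurable_id.
  rewrite (normal_cos _ _ (oner_neq0 R)) big_cons exprMn c2.
  rewrite (_ : - (_ + _) = - \sum_(j <- r) s j * U j w ^+ 2 -
      1 ^+ 2 * (2 * s k * U k w ^+ 2) / 2); last by field.
  by rewrite expRD; ring.
rewrite (@Fubini_bounded _ _ _ _ _ P (normal_prob 0 1)
  (fun w g => expR (- \sum_(j <- r) s j * U j w ^+ 2) * cos (\sum_j a' g j * U j w)) 1); first last.
- move=> w g; rewrite normrM ger0_norm ?expR_ge0// mulr_ile1 ?expR_ge0//.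
    by rewrite -expR0 ler_expR oppr_le0 sumr_ge0// => j _; rewrite mulr_ge0// sqr_ge0.
  by rewrite ler_norml cos_geN1 cos_le1.
- apply: measurable_funM.
    exact: (measurableT_comp mS measurable_fst).
  apply: measurableT_comp; first exact: (continuous_measurable_fun (@continuous_cos R)).
  under eq_fun do rewrite sa'.
  apply: measurable_funD.
    apply: measurable_funM; last exact: measurable_snd.
    by apply: measurable_funM => //; exact: (measurableT_comp (mU k) measurable_fst).
  apply: measurable_sum => j; apply: measurable_funM => //.
  exact: (measurableT_comp (mU j) measurable_fst).
under eq_Rintegral do rewrite IH// (bigD1 k)//= (negbTE kr) /a' eqxx mul1r.
under eq_Rintegral => g _.
  under eq_bigr => j jk do rewrite (negbTE jk) mul0r addr0.
  over.
rewrite RintegralZr//; last first.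
  apply: (@integrable_bounded _ _ _ _ _ 1) => [|x].
    apply: measurableT_comp => //; apply: measurableT_comp => //.
    apply: measurable_funM => //; apply: measurable_funM => //.
    apply: measurable_funX; apply: measurable_funD => //.
  rewrite ger0_norm ?expR_ge0// -expR0 ler_expR oppr_le0 divr_ge0// mulr_ge0 ?sqr_ge0//.
  exact: coord_variance_ge0.
rewrite [RHS](bigD1 k)//= inE eqxx /=; congr (_ * _).
by apply: eq_bigr => j jk; rewrite inE (negbTE jk).
Qed.

(** The Laplace transform factorizes, as if the coordinates were independent
    normal variables. *)
Lemma laplace_squares (s : 'I_n -> R) : (forall j, 0 <= s j) ->
  \int[P]_w expR (- \sum_j s j * U j w ^+ 2) =
  \prod_j (Num.sqrt (1 + 2 * (s j * l j)))^-1.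
Proof.
move=> s0; have := mixed_transform s0 (enum_uniq 'I_n) (fun=> 0).
under eq_Rintegral => w _.
  rewrite [X in cos X]big1; last by move=> j _; rewrite mul0r.
  rewrite cos0 mulr1 big_enum /=.
  over.
move=> ->; apply: eq_bigr => j _.
by rewrite mem_enum inE smoothed_transform0//; exact: coord_variance_ge0.
Qed.
End Laplace.

(** * Moments and tilted moments of Gaussian squares *)

Section Moments.
Context (R : realType) (d : measure_display) (Omega : measurableType d) (P : probability Omega R).
Variables (n : nat) (U : 'I_n -> Omega -> R) (l : 'I_n -> R).
Hypothesis mU : forall j, measurable_fun setT (U j).
Hypothesis gaussU : forall a : 'I_n -> R,
  centred_gaussian P (fun w => \sum_j a j * U j w) (\sum_j a j ^+ 2 * l j).

Let l0 j : 0 <= l j. Proof. exact: (coord_variance_ge0 gaussU). Qed.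

Lemma centred_gaussian_coord j : centred_gaussian P (U j) (l j).
Proof.
have := gaussU (fun i => (i == j)%:R).
rewrite (_ : (fun w => _) = U j); last first.
  apply/funext => w; rewrite (bigD1 j)//= eqxx mul1r big1 ?addr0// => i ij.
  by rewrite (negbTE ij) mul0r.
rewrite (bigD1 j)//= eqxx expr1n mul1r big1 ?addr0// => i ij.
by rewrite (negbTE ij) expr0n mul0r.
Qed.

Lemma centred_gaussian_pair (e : R) j k : j != k -> e ^+ 2 = 1 ->
  centred_gaussian P (fun w => U j w + e * U k w) (l j + l k).
Proof.
move=> jk e2; have := gaussU (fun i => (i == j)%:R + e * (i == k)%:R).
have ns (F : 'I_n -> R) i0 : \sum_i (i == i0)%:R * F i = F i0.
  rewrite (bigD1 i0)//= eqxx mul1r big1 ?addr0// => i ij.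
  by rewrite (negbTE ij) mul0r.
rewrite (_ : (fun w => _) = (fun w => U j w + e * U k w)); last first.
  apply/funext => w; under eq_bigr do rewrite mulrDl.
  rewrite big_split/= ns; congr (_ + _).
  by under eq_bigr do rewrite -mulrA; rewrite -mulr_sumr ns.
rewrite (_ : \sum_j _ = l j + l k)//.
under eq_bigr do rewrite sqrrD mulrDl mulrDl.
rewrite !big_split/= (_ : \sum_i (_ *+ 2 * _) = 0); last first.
  apply: big1 => i _; have [->|ij] := eqVneq i j; last by rewrite mul0r mul0rn mul0r.
  by rewrite (negbTE jk) !mulr0 mul0rn mul0r.
rewrite addr0; congr (_ + _).
  by rewrite -[RHS](ns l j); apply: eq_bigr => i _; case: (i == j); rewrite ?expr1n ?expr0n.
rewrite -[RHS](ns l k); apply: eq_bigr => i _; rewrite exprMn e2 mul1r.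
by case: (i == k); rewrite ?expr1n ?expr0n.
Qed.

Let iU j k : (k <= 8)%N -> P.-integrable setT (EFin \o (fun w => U j w ^+ k)).
Proof. by have [_ _ + _ _] := centred_gaussian_coord j; exact. Qed.

Let iU2 j : P.-integrable setT (EFin \o (fun w => U j w ^+ 2)).
Proof. exact: iU. Qed.

Lemma product_integrable j k :
  P.-integrable setT (EFin \o (fun w => U j w ^+ 2 * U k w ^+ 2)).
Proof.
apply: (@dominated_integrable _ _ _ _ _ (fun w => U j w ^+ 4 + U k w ^+ 4)).
- by apply: measurable_funM; exact: measurable_funX.
- move=> w; rewrite ger0_norm; last exact: (mulr_ge0 (sqr_ge0 _) (sqr_ge0 _)).
  rewrite (exprM _ 2 2) (exprM _ 2 2).
  have := sqr_ge0 (U j w ^+ 2 - U k w ^+ 2).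
  have := sqr_ge0 (U j w ^+ 2); have := sqr_ge0 (U k w ^+ 2).
  by move: (U j w ^+ 2) (U k w ^+ 2) => x y; nra.
- exact: (integrableD_EFin (iU j (isT : 4 <= 8)%N) (iU k (isT : 4 <= 8)%N)).
Qed.

(** Polarization:
    [12 * x ^+ 2 * y ^+ 2 = (x + y) ^+ 4 + (x - y) ^+ 4 - 2 * (x ^+ 4 + y ^+ 4)],
    so the mixed moment follows from fourth moments of linear forms. *)
Lemma product_moment j k :
  \int[P]_w (U j w ^+ 2 * U k w ^+ 2) = l j * l k + (if j == k then 2 * l j ^+ 2 else 0).
Proof.
have [<-|jk] := eqVneq j k.
  have [_ _ _ _ H] := centred_gaussian_coord j.
  under eq_Rintegral do rewrite -exprD.
  by rewrite H; ring.
have [_ _ _ _ Hj] := centred_gaussian_coord j.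
have [_ _ _ _ Hk] := centred_gaussian_coord k.
have [_ _ ip _ Hp] := centred_gaussian_pair jk (expr1n R 2).
have [|_ _ im _ Hm] := centred_gaussian_pair (e := -1) jk; first by rewrite sqrrN expr1n.
have -> : (fun w => U j w ^+ 2 * U k w ^+ 2) = (fun w => 12^-1 *
    (((U j w + 1 * U k w) ^+ 4 + (U j w + -1 * U k w) ^+ 4) - 2 * (U j w ^+ 4 + U k w ^+ 4))).
  by apply/funext => w; field.
have ipm := integrableD_EFin (ip 4%N isT) (im 4%N isT).
have ijk := integrableD_EFin (iU j (isT : 4 <= 8)%N) (iU k (isT : 4 <= 8)%N).
rewrite RintegralZl//; last by apply: integrableB_EFin => //; exact: integrableZ_EFin.
rewrite RintegralB//; last exact: integrableZ_EFin.
rewrite RintegralZl// !RintegralD//; [|exact: iU|exact: iU|exact: ip|exact: im].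
by rewrite Hp Hm Hj Hk; field.
Qed.

Let X j w := U j w ^+ 2 - l j.

Lemma square_mean j : \int[P]_w (U j w ^+ 2) = l j.
Proof. by have [_ _ _ ->] := centred_gaussian_coord j. Qed.

Lemma centred_square_cov j k :
  P.-integrable setT (EFin \o (fun w => X j w * X k w)) /\
  \int[P]_w (X j w * X k w) = if j == k then 2 * l j ^+ 2 else 0.
Proof.
have -> : (fun w => X j w * X k w) = (fun w => U j w ^+ 2 * U k w ^+ 2 -
    (l k * U j w ^+ 2 + l j * U k w ^+ 2 - l j * l k)).
  by apply/funext => w; rewrite /X; ring.
have i1 : P.-integrable setT (EFin \o (fun w => l k * U j w ^+ 2 + l j * U k w ^+ 2)).
  exact: (integrableD_EFin (integrableZ_EFin _ (iU2 j)) (integrableZ_EFin _ (iU2 k))).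
have i2 := integrableB_EFin i1 (integrable_cst_prob P (l j * l k)).
have i3 := product_integrable j k.
split; first exact: integrableB_EFin.
rewrite !RintegralB//; last exact: integrable_cst_prob.
rewrite (RintegralD measurableT (integrableZ_EFin (l k) (iU2 j)) (integrableZ_EFin (l j) (iU2 k))).
rewrite !RintegralZl//; last exact: integrable_cst_prob.
by rewrite (Rintegral_cst_prob P (l k)) product_moment !square_mean; ring.
Qed.

(** Centred squares of distinct coordinates are uncorrelated, and each has
    variance [2 * l j ^+ 2]. *)
Lemma centred_form_variance (c : 'I_n -> R) :
  P.-integrable setT (EFin \o (fun w => (\sum_j c j * X j w) ^+ 2)) /\
  \int[P]_w (\sum_j c j * X j w) ^+ 2 = 2 * \sum_j c j ^+ 2 * l j ^+ 2.
Proof.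
have -> : (fun w => (\sum_j c j * X j w) ^+ 2) =
    (fun w => \sum_j \sum_k (c j * c k) * (X j w * X k w)).
  apply/funext => w; rewrite expr2 big_distrl/=; apply: eq_bigr => j _.
  by rewrite big_distrr/=; apply: eq_bigr => k _; ring.
have iX j k : P.-integrable setT (EFin \o (fun w => (c j * c k) * (X j w * X k w))).
  by apply: integrableZ_EFin; exact: (centred_square_cov j k).1.
have iXs j : P.-integrable setT (EFin \o (fun w => \sum_k (c j * c k) * (X j w * X k w))).
  by apply: integrable_sum_EFin => k; exact: iX.
split; first exact: integrable_sum_EFin.
rewrite Rintegral_sum// mulr_sumr; apply: eq_bigr => j _.
rewrite Rintegral_sum// (bigD1 j)//= big1 ?addr0 => [|k kj].
  rewrite RintegralZl//; last exact: (centred_square_cov j j).1.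
  by rewrite (centred_square_cov j j).2 eqxx; ring.
rewrite RintegralZl//; last exact: (centred_square_cov j k).1.
by rewrite (centred_square_cov j k).2 eq_sym (negbTE kj) mulr0.
Qed.

Lemma cube_sum_le (I : Type) (r : seq I) (x : I -> R) : (forall i, 0 <= x i) ->
  (\sum_(i <- r) x i) ^+ 3 <= 4 ^+ size r * \sum_(i <- r) x i ^+ 3.
Proof.
move=> x0; elim: r => [|i r IH]; first by rewrite !big_nil expr0n mulr0.
rewrite !big_cons /= [4 ^+ _]exprS.
have s0 : 0 <= \sum_(j <- r) x j by exact: sumr_ge0.
have h1 : (x i + \sum_(j <- r) x j) ^+ 3 <= 4 * (x i ^+ 3 + (\sum_(j <- r) x j) ^+ 3).
  move: (x i) (x0 i) (\sum_(j <- r) x j) s0 => a a0 b b0.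
  have := mulr_ge0 (addr_ge0 a0 b0) (sqr_ge0 (a - b)); nra.
apply: (le_trans h1); rewrite -mulrA ler_pM2l// mulrDr lerD//.
by rewrite ler_peMl ?exprn_ge0// exprn_ege1// ler1n.
Qed.

Lemma square_norm_cube_integrable :
  P.-integrable setT (EFin \o (fun w => (\sum_j U j w ^+ 2) ^+ 3)).
Proof.
apply: (@dominated_integrable _ _ _ _ _ (fun w => 4 ^+ size (index_enum 'I_n) * \sum_j U j w ^+ 6)).
- apply: measurable_funX; apply: measurable_sum => j; exact: measurable_funX.
- move=> w; rewrite ger0_norm ?exprn_ge0 ?sumr_ge0// => [|j _]; last exact: sqr_ge0.
  apply: (le_trans (cube_sum_le _ _)) => [i|]; first exact: sqr_ge0.
  rewrite le_eqVlt; apply/orP; left; apply/eqP; congr (_ * _).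
  by apply: eq_bigr => j _; rewrite -exprM.
- by apply: integrableZ_EFin; apply: integrable_sum_EFin => j; exact: iU.
Qed.

Lemma weighted_square_integrable k s : 0 <= s ->
  P.-integrable setT (EFin \o (fun w => U k w ^+ 2 * expR (- (s * \sum_j U j w ^+ 2)))).
Proof.
move=> s0; apply: (@dominated_integrable _ _ _ _ _ (fun w => U k w ^+ 2)).
- apply: measurable_funM; first exact: measurable_funX.
  do 2 apply: measurableT_comp => //; apply: measurable_funM => //.
  by apply: measurable_sum => j; exact: measurable_funX.
- move=> w; rewrite normrM !ger0_norm ?sqr_ge0 ?expR_ge0// ler_piMr ?sqr_ge0//.
  rewrite -expR0 ler_expR oppr_le0 mulr_ge0 ?sumr_ge0// => j _; exact: sqr_ge0.
- exact: iU.
Qed.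

(** Differentiating the Laplace transform in the [k]-th parameter.  Instead of
    exchanging derivative and expectation, one uses that
    [expR (- x) >= 1 - x] makes [s] a minimum of
    [fun t => E (expR (- t * U k ^+ 2 - rest)) + t * E (U k ^+ 2 * expR (- s * T))],
    where [T] is the sum of the squares and [rest] is [s] times the sum of the
    other ones; the vanishing of the derivative there is the assertion. *)
Lemma weighted_square_mean k s : 0 < s ->
  (1 + 2 * s * l k) * \int[P]_w (U k w ^+ 2 * expR (- (s * \sum_j U j w ^+ 2))) =
  l k * \int[P]_w expR (- (s * \sum_j U j w ^+ 2)).
Proof.
move=> s0; set A := (X in _ * X = _); set B := (X in _ = _ * X).
pose F t w := expR (- \sum_j (if j == k then t else s) * U j w ^+ 2).
have FE t w : F t w = expR (- (t * U k w ^+ 2 + \sum_(j | j != k) s * U j w ^+ 2)).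
  rewrite /F (bigD1 k)//= eqxx; congr (expR (- (_ + _))).
  by apply: eq_bigr => j jk; rewrite (negbTE jk).
have FsE w : F s w = expR (- (s * \sum_j U j w ^+ 2)).
  by rewrite /F mulr_sumr; congr (expR (- _)); apply: eq_bigr => j _; case: ifP.
have iF t : 0 <= t -> P.-integrable setT (EFin \o F t).
  move=> t0; apply: (@integrable_bounded _ _ _ _ _ 1) => [|w].
    do 2 apply: measurableT_comp => //; apply: measurable_sum => j.
    by apply: measurable_funM => //; exact: measurable_funX.
  rewrite ger0_norm ?expR_ge0// -expR0 ler_expR oppr_le0 sumr_ge0// => j _.
  by rewrite mulr_ge0 ?sqr_ge0//; case: ifP => // _; exact: ltW.
pose c := \prod_(j | j != k) (Num.sqrt (1 + 2 * (s * l j)))^-1.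
pose m t := (Num.sqrt (1 + 2 * (t * l k)))^-1.
have IF t : 0 <= t -> \int[P]_w F t w = m t * c.
  move=> t0; rewrite /F (laplace_squares mU gaussU); last first.
    by move=> j; case: ifP => // _; exact: ltW.
  rewrite (bigD1 k)//= eqxx; congr (_ * _).
  by apply: eq_bigr => j jk; rewrite (negbTE jk).
have iA := weighted_square_integrable k (ltW s0).
have pos t : 0 <= t -> 0 < 1 + 2 * (t * l k).
  by move=> t0; rewrite ltr_pwDl// mulr_ge0// mulr_ge0.
have dm (t : R) : 0 < t -> is_derive t (1 : R) (fun t : R => m t * c + t * A)
    (- l k / (1 + 2 * (t * l k)) * m t * c + A).
  move=> t0; have p := pos _ (ltW t0).
  have sp : 0 < Num.sqrt (1 + 2 * (t * l k)) by rewrite sqrtr_gt0.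
  have h1 : is_derive t (1 : R) (fun t : R => 1 + 2 * (t * l k)) (2 * l k).
    by apply: is_derive_eq; rewrite /GRing.scale /=; ring.
  have h2 := @is_derive1_comp _ Num.sqrt (fun t : R => 1 + 2 * (t * l k)) t _ _ (is_derive1_sqrt p) h1.
  have h3 := @is_deriveV _ (fun t : R => Num.sqrt (1 + 2 * (t * l k))) t _ 1 (lt0r_neq0 sp) h2.
  apply: is_derive_eq; rewrite /GRing.scale /= /m.
  rewrite -[X in - l k / X](sqr_sqrtr (ltW p)).
  by field; rewrite gt_eqF.
(* From expR ((s - t) * x) >= 1 + (s - t) * x. *)
have mn t : t \in `]0, (2 * s)[ -> m s * c + s * A <= m t * c + t * A.
  rewrite in_itv/= => /andP[t0 _].
  suff : (s - t) * A <= m t * c - m s * c by rewrite mulrBl; lra.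
  rewrite -(IF t (ltW t0)) -(IF s (ltW s0)) -RintegralB//; [|exact: iF (ltW t0)|exact: iF (ltW s0)].
  rewrite -RintegralZl//; apply: le_Rintegral => //.
  - exact: integrableZ_EFin.
  - exact: (integrableB_EFin (iF _ (ltW t0)) (iF _ (ltW s0))).
  - move=> w _; rewrite -FsE.
    have -> : F t w = F s w * expR ((s - t) * U k w ^+ 2).
      by rewrite !FE -expRD; congr expR; ring.
    have := ler_wpM2l (expR_ge0 (- \sum_j (if j == k then s else s) * U j w ^+ 2))
      (expR_ge1Dx ((s - t) * U k w ^+ 2)).
    by rewrite -/(F s w); lra.
have sI : s \in `]0, (2 * s)[ by rewrite in_itv/= s0; lra.
have s20 : 0 <= 2 * s by lra.
have dr (t : R) : t \in `]0, (2 * s)[ -> derivable (fun t : R => m t * c + t * A) t 1.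
  rewrite in_itv/= => /andP[t0 _]; exact: (@ex_derive _ _ _ _ _ _ _ (dm t t0)).
have D0 := derive1_at_min s20 dr sI mn.
have Ds := dm s s0.
have E0 : - l k / (1 + 2 * (s * l k)) * m s * c + A = 0.
  by rewrite -(@derive_val _ _ _ _ _ _ _ Ds) (@derive_val _ _ _ _ _ _ _ D0).
have -> : B = m s * c.
  by rewrite -IF ?ltW//; apply: eq_Rintegral => w _; rewrite FsE.
have -> : A = l k / (1 + 2 * (s * l k)) * m s * c by lra.
by field; rewrite gt_eqF// pos// ltW.
Qed.

End Moments.

(** * Weierstrass approximation *)

Section Bernstein.
Variable R : realType.

(** The [n]-th Bernstein polynomial of [g], with nodes [0, 1, ..., n]: its value
    at [x] is the mean of [g] at a binomial variable with parameters [n] and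
    [x].  Conditioning on the first trial gives the recursion, which makes
    positivity and the first two moments immediate inductions. *)
Fixpoint bernstein (n : nat) (g : nat -> R) : {poly R} :=
  if n is m.+1 then 'X * bernstein m (g \o succn) + (1 - 'X) * bernstein m g
  else (g 0%N)%:P.

Lemma bernsteinS (m : nat) (g : nat -> R) (x : R) : (bernstein m.+1 g).[x] =
  x * (bernstein m (g \o succn)).[x] + (1 - x) * (bernstein m g).[x].
Proof. by rewrite /= !hornerE. Qed.

Lemma bernstein_le (n : nat) (g h : nat -> R) (x : R) : 0 <= x <= 1 ->
  (forall k, (k <= n)%N -> g k <= h k) ->
  (bernstein n g).[x] <= (bernstein n h).[x].
Proof.
move=> /andP[x0 x1]; elim: n g h => [|n IH] g h gh.
  by rewrite /= !hornerC gh.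
rewrite !bernsteinS; apply: lerD; apply: ler_wpM2l => //.
- by apply: IH => k kn; exact: gh.
- by rewrite subr_ge0.
- by apply: IH => k kn; apply: gh; exact: leqW.
Qed.

Lemma bernstein_quadratic (n : nat) (a b c x : R) :
  (bernstein n (fun k => a + b * k%:R + c * k%:R ^+ 2)).[x] =
  a + b * (n%:R * x) + c * (n%:R ^+ 2 * x ^+ 2 + n%:R * x * (1 - x)).
Proof.
elim: n a b c => [|n IH] a b c; first by rewrite /= hornerC; ring.
rewrite bernsteinS.
have -> : (fun k => a + b * k%:R + c * k%:R ^+ 2) \o succn =
    (fun k => (a + b + c) + (b + 2 * c) * k%:R + c * k%:R ^+ 2).
  by apply/funext => k /=; rewrite -natr1; ring.
by rewrite !IH -natr1; ring.
Qed.

Lemma uniformly_continuous01 (f : R -> R) (e : R) : continuous f -> 0 < e ->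
  exists2 dl : R, 0 < dl & forall x y, 0 <= x <= 1 -> `|x - y| < dl -> `|f x - f y| <= e.
Proof.
move=> cf e0.
have /compact_near_coveringP cpt := @segment_compact R 0 1.
have := cpt R (0^'+) (fun dl x => forall y, `|x - y| < dl -> `|f x - f y| <= e) _.
case=> [x _|dl /= dl0 H].
  have e20 : 0 < e / 2 by rewrite divr_gt0.
  have /cvgrPdist_le/(_ _ e20)/nbhs_ballP[r /= r0 rf] := cf x.
  exists (ball x (r / 2), [set dl | dl < r / 2]) => /=.
    split; first by apply: nbhsx_ballx; rewrite divr_gt0.
    by apply: nbhs_right_lt; rewrite divr_gt0.
  move=> [x' dl] /= [xx' dlr] y x'y.
  have h1 : `|f x - f x'| <= e / 2.
    by apply: rf; rewrite /ball/= (lt_le_trans xx')// ler_pdivrMr//; lra.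
  have h2 : `|f x - f y| <= e / 2.
    apply: rf; rewrite /ball/= -(subrK x' x) -addrA (le_lt_trans (ler_normD _ _))//.
    have := xx'; rewrite /ball /=; lra.
  rewrite -(subrK (f x) (f x')) -addrA (le_trans (ler_normD _ _))//
    [leLHS](_ : _ = `|f x - f x'| + `|f x - f y|).
    by lra.
  by rewrite distrC.
exists (dl / 2); first by rewrite divr_gt0.
move=> x y x01 xy; apply: (H (dl / 2)) => //=.
- by rewrite sub0r normrN gtr0_norm ?divr_gt0//; lra.
- by rewrite divr_gt0.
Qed.

(** Uniform continuity gives
    [`|f x - f y| <= e / 2 + K * (x - y) ^+ 2], and the mean square distance
    from [x] to the nodes is [x * (1 - x) / n]. *)
Lemma weierstrass01 (f : R -> R) (e : R) : continuous f -> 0 < e ->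
  exists q : {poly R}, forall x, 0 <= x <= 1 -> `|f x - q.[x]| <= e.
Proof.
move=> cf e0; have e20 : 0 < e / 2 by rewrite divr_gt0.
have [dl dl0 Hdl] := uniformly_continuous01 cf e20.
have [M M0 HM] : exists2 M : R, 0 <= M & forall x, 0 <= x <= 1 -> `|f x| <= M.
  have [|c c01 Hc] := @EVT_max R (fun x => `|f x|) 0 1 ler01.
    by apply: continuous_subspaceT => x; apply: continuous_comp; [exact: cf|exact: norm_continuous].
  exists `|f c| => // x x01; apply: Hc; rewrite in_itv/=; exact: x01.
pose K := 2 * M / dl ^+ 2.
have K0 : 0 <= K by rewrite divr_ge0 ?mulr_ge0 ?exprn_ge0// ltW.
have HK x y : 0 <= x <= 1 -> 0 <= y <= 1 -> `|f x - f y| <= e / 2 + K * (x - y) ^+ 2.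
  move=> x01 y01; have [xy|xy] := ltP `|x - y| dl.
    by rewrite (le_trans (Hdl _ _ x01 xy))// lerDl mulr_ge0 ?sqr_ge0.
  apply: (@le_trans _ _ (2 * M)).
    rewrite (le_trans (ler_normB _ _))//; have := HM _ x01; have := HM _ y01; lra.
  have d2 : 0 < dl ^+ 2 by rewrite exprn_gt0.
  have : dl ^+ 2 <= (x - y) ^+ 2.
    by rewrite -[leRHS]real_normK ?num_real// ler_pXn2r// ?nnegrE ?(ltW dl0).
  move=> /(ler_wpM2l K0); rewrite {1}/K divfK ?gt_eqF// => h; lra.
pose n := (Num.truncn (K / e)).+1.
have n0 : 0 < n%:R :> R by rewrite ltr0n.
have Kn : K / n%:R <= e.
  by rewrite ler_pdivrMr// mulrC -ler_pdivrMr// ltW// /n truncnS_gt.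
exists (bernstein n (fun k => f (k%:R / n%:R))) => x x01.
have kn k : (k <= n)%N -> 0 <= (k%:R / n%:R : R) <= 1.
  by move=> kn; rewrite divr_ge0//= ler_pdivrMr// mul1r ler_nat.
have bnd : K * (x * (1 - x) / n%:R) <= e / 2.
  case/andP: x01 => x0 x1.
  have h : x * (1 - x) <= 1 / 4 by have := sqr_ge0 (x - 1 / 2); nra.
  have -> : K * (x * (1 - x) / n%:R) = x * (1 - x) * (K / n%:R).
    by field; rewrite gt_eqF.
  have kn0 : 0 <= K / n%:R by rewrite divr_ge0.
  by have := ler_wpM2r kn0 h; lra.
have quad (s : R) : (bernstein n (fun k => f x + s * (e / 2 + K * (k%:R / n%:R - x) ^+ 2))).[x] =
   f x + s * (e / 2 + K * (x * (1 - x) / n%:R)).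
  rewrite (_ : (fun k => _) = (fun k => (f x + s * (e / 2 + K * x ^+ 2)) +
     (- s * K * 2 * x / n%:R) * k%:R + (s * K / n%:R ^+ 2) * k%:R ^+ 2)).
    by rewrite bernstein_quadratic; field; rewrite gt_eqF.
  by apply/funext => k; field; rewrite gt_eqF.
rewrite ler_distlC; apply/andP; split.
- apply: (@le_trans _ _ (bernstein n (fun k => f x + (-1) * (e / 2 + K * (k%:R / n%:R - x) ^+ 2))).[x]).
    by rewrite quad; lra.
  apply: bernstein_le => // k /kn k01; have := HK _ _ k01 x01; rewrite ler_norml => /andP[]; lra.
- apply: (@le_trans _ _ (bernstein n (fun k => f x + 1 * (e / 2 + K * (k%:R / n%:R - x) ^+ 2))).[x]).
    apply: bernstein_le => // k /kn k01; have := HK _ _ k01 x01; rewrite ler_norml => /andP[]; lra.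
  by rewrite quad; lra.
Qed.
End Bernstein.

(** * From exponentials to continuously differentiable functions *)

Section Calculus.
Variable R : realType.

Lemma increment_le_derive_bound (F f : R -> R) (B x : R) :
  (forall y, is_derive y (1 : R) F (f y)) -> 0 <= x ->
  (forall y, 0 <= y <= x -> `|f y| <= B) -> `|F x - F 0| <= B * x.
Proof.
move=> dF x0 fB.
have [|z zx ->] := @MVT_segment R F f 0 x x0 (fun y _ => dF y).
  by apply: continuous_subspaceT; exact: is_derive_continuous dF.
rewrite subr0 normrM (ger0_norm x0) ler_wpM2r// fB//.
Qed.

(** In the variable [w = expR (- eta * x)] the function
    [psi x * expR (- eta * x)] extends continuously to [w = 0], that is to
    infinity.  The weight is what makes polynomial approximation in [w]
    possible without any decay of [psi]. *)
Lemma exp_weighted_continuous (psi : R -> R) (K eta : R) : 0 < eta ->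
  continuous psi -> (forall x, `|psi x| <= K) ->
  continuous (fun w => psi (- ln w / eta) * w).
Proof.
move=> eta0 cpsi psiK w.
have K0 : 0 <= K := le_trans (normr_ge0 _) (psiK 0).
have [w0|w0|->] := ltgtP w 0.
- apply: cvgM; last exact: cvg_id.
  apply: cvg_near_cst; near=> y; rewrite !ln0 ?(ltW w0)// ltW//.
  by near: y; exact: lt_nbhsl.
- apply: cvgM; last exact: cvg_id.
  apply: continuous_comp; last exact: cpsi.
  apply: cvgM; last exact: cvg_cst.
  by apply: cvgN; exact: continuous_ln.
- apply/cvgrPdist_le => e e0.
  have : \forall y \near (0 : R), `|y| <= e / (K + 1).
    by apply: nbhs0_le; rewrite divr_gt0// ltr_wpDl.
  apply: filterS => y ye.
  rewrite mulr0 sub0r normrN normrM (le_trans (ler_wpM2r _ (psiK _)))//.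
  rewrite (@le_trans _ _ ((K + 1) * `|y|))//; first by rewrite ler_wpM2r// lerDl.
  by rewrite mulrC -ler_pdivlMr ?ltr_wpDl.
Unshelve. all: by end_near. Qed.
End Calculus.

Section Extension.
Context (R : realType) (d : measure_display) (Omega : measurableType d) (P : probability Omega R).
Variables (T Q : Omega -> R) (m L : R).
Hypotheses (mT : measurable_fun setT T) (mQ : measurable_fun setT Q).
Hypotheses (T0 : forall w, 0 <= T w) (L0 : 0 <= L) (QL : forall w, 0 <= Q w <= L * T w).
Hypothesis iT3 : P.-integrable setT (EFin \o (fun w => T w ^+ 3)).
Hypothesis Tmean : \int[P]_w (T w - m) = 0.
Hypothesis Tvar : \int[P]_w ((T w - m) * T w - 2 * Q w) = 0.
Hypothesis Tlap : forall s, 0 < s ->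
  \int[P]_w ((T w - m) * expR (- (s * T w)) + 2 * s * (Q w * expR (- (s * T w)))) = 0.

Let D w := 1 + T w ^+ 3.
Let iD : P.-integrable setT (EFin \o D).
Proof. exact: (integrableD_EFin (integrable_cst_prob P 1) iT3). Qed.

Let pow_D w k : (k <= 3)%N -> 0 <= T w ^+ k <= D w.
Proof.
move=> k3; rewrite exprn_ge0//=; have [x1|x1] := leP (T w) 1.
  by rewrite (le_trans (exprn_ile1 _ (T0 w) x1))// lerDl exprn_ge0.
by rewrite (le_trans (ler_weXn2l (ltW x1) k3))// lerDr.
Qed.

(** The identity to be proved for [f] and its derivative [psi] is that this
    variable has mean 0. *)
Let defect (f psi : R -> R) w := (T w - m) * f (T w) - 2 * (Q w * psi (T w)).

(** The growth condition is the one satisfied by the approximation error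
    below, where [a] and [b] are small; the third moment of [T] then controls the
    defect. *)
Let defect_bound f psi a b w : 0 <= a -> 0 <= b ->
  `|f (T w)| <= a + b * T w + b * T w ^+ 2 -> `|psi (T w)| <= b + b * T w ->
  `|defect f psi w| <= (a + 2 * b) * (1 + `|m|) * (2 + 4 * L) * D w.
Proof.
move=> a0 b0 fa pb.
have [q0 qL] := andP (QL w).
have h : `|defect f psi w| <= (T w + `|m|) * (a + b * T w + b * T w ^+ 2) + 2 * (L * T w * (b + b * T w)).
  rewrite (le_trans (ler_normB _ _))// !normrM lerD//.
    rewrite ler_pM// (le_trans (ler_normB _ _))// ger0_norm//.
  by rewrite ger0_norm// ler_wpM2l// ger0_norm// ler_pM.
apply: (le_trans h).
have /andP[_] := pow_D w (isT : 0 <= 3)%N; rewrite expr0.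
have /andP[_] := pow_D w (isT : 1 <= 3)%N; rewrite expr1.
have /andP[_] := pow_D w (isT : 2 <= 3)%N.
have /andP[_] := pow_D w (isT : 3 <= 3)%N.
have t0 := T0 w; have M0 := normr_ge0 m.
rewrite (_ : _ + _ = a * T w + b * T w ^+ 2 + b * T w ^+ 3 + `|m| * a * T w ^+ 0
  + `|m| * b * T w + `|m| * b * T w ^+ 2 + 2 * L * b * T w + 2 * L * b * T w ^+ 2); last by ring.
rewrite expr0; move: (D w) (T w) (T w ^+ 2) (T w ^+ 3) `|m| M0 t0 => D1 t t2 t3 M M0 t0 h3 h2 h1 h0.
have D0 : 0 <= D1 by lra.
have Ma := mulr_ge0 M0 a0; have Mb := mulr_ge0 M0 b0; have Lb := mulr_ge0 L0 b0.
have La := mulr_ge0 L0 a0; have LMa := mulr_ge0 L0 Ma; have LMb := mulr_ge0 L0 Mb.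
apply: (@le_trans _ _ ((a + 2 * b + M * a + 2 * (M * b) + 4 * (L * b)) * D1)).
  have := ler_wpM2l a0 h1; have := ler_wpM2l b0 h2; have := ler_wpM2l b0 h3.
  have := ler_wpM2l Ma h0; have := ler_wpM2l Mb h1; have := ler_wpM2l Mb h2.
  have := ler_wpM2l Lb h1; have := ler_wpM2l Lb h2; lra.
by apply: ler_wpM2r => //; lra.
Qed.

Let measurable_defect (f psi : R -> R) : continuous f -> continuous psi ->
  measurable_fun setT (defect f psi).
Proof.
move=> cf cpsi; apply: measurable_funB.
  apply: measurable_funM; first exact: measurable_funB.
  exact: (measurableT_comp (continuous_measurable_fun cf) mT).
apply: measurable_funM => //; apply: measurable_funM => //.
exact: (measurableT_comp (continuous_measurable_fun cpsi) mT).
Qed.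

Let integrable_defect (f psi : R -> R) (a b : R) : 0 <= a -> 0 <= b ->
  continuous f -> continuous psi ->
  (forall x, 0 <= x -> `|f x| <= a + b * x + b * x ^+ 2) ->
  (forall x, 0 <= x -> `|psi x| <= b + b * x) ->
  P.-integrable setT (EFin \o defect f psi) /\
  `|\int[P]_w defect f psi w| <= (a + 2 * b) * (1 + `|m|) * (2 + 4 * L) * \int[P]_w D w.
Proof.
move=> a0 b0 cf cp fa pb; have md := measurable_defect cf cp.
have db w := defect_bound a0 b0 (fa _ (T0 w)) (pb _ (T0 w)).
have iC := integrableZ_EFin ((a + 2 * b) * (1 + `|m|) * (2 + 4 * L)) iD.
split; first exact: dominated_integrable md db iC.
by rewrite -RintegralZl//; exact: Rintegral_norm_le md db iC.
Qed.

Let expo (eta : R) (i : nat) (x : R) := expR (- (i%:R * eta * x)).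
(** The primitives of the exponentials vanishing at 0, including the
    constant exponential. *)
Let expo_prim (eta : R) (i : nat) (x : R) :=
  if i is 0%N then x else (1 - expo eta i x) / (i%:R * eta).

Let expo_prim0 eta i : expo_prim eta i 0 = 0.
Proof. by rewrite /expo_prim; case: i => // i; rewrite /expo mulr0 oppr0 expR0 subrr mul0r. Qed.

Let expo_prim_derive eta i (x : R) : 0 < eta ->
  is_derive x (1 : R) (expo_prim eta i) (expo eta i x).
Proof.
move=> eta0; rewrite /expo_prim; case: i => [|i].
  rewrite /expo !mul0r oppr0 expR0; exact: is_derive_id.
by apply: is_derive_eq; rewrite /GRing.scale /= /expo; field; rewrite gt_eqF//= addrC natr1.
Qed.

Let expo_bounds eta i (x : R) : 0 < eta -> 0 <= x -> `|expo eta i x| <= 1.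
Proof.
move=> eta0 x0; rewrite ger0_norm ?expR_ge0// -expR0 ler_expR oppr_le0.
by rewrite !mulr_ge0// ltW.
Qed.

Let defect_expo (eta : R) i : 0 < eta ->
  P.-integrable setT (EFin \o defect (expo_prim eta i) (expo eta i)) /\
  \int[P]_w defect (expo_prim eta i) (expo eta i) w = 0.
Proof.
move=> eta0.
have dE x := expo_prim_derive i x eta0.
have cE : continuous (expo eta i).
  move=> x; apply: continuous_comp; last exact: continuous_expR.
  by apply: cvgN; apply: cvgM; [exact: cvg_cst|exact: cvg_id].
have pE x : 0 <= x -> `|expo_prim eta i x| <= 0 + 1 * x + 1 * x ^+ 2.
  move=> x0; have := increment_le_derive_bound dE x0 (B := 1).
  rewrite expo_prim0 subr0 => /(_ _)/le_trans; apply.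
    by move=> y /andP[y0 _]; exact: expo_bounds.
  by rewrite add0r !mul1r lerDl sqr_ge0.
have bE x : 0 <= x -> `|expo eta i x| <= 1 + 1 * x.
  by move=> x0; rewrite (le_trans (expo_bounds i eta0 x0))// mul1r lerDl.
have [iE _] := integrable_defect (lexx 0) ler01 (is_derive_continuous dE) cE pE bE.
split => //; case: i dE cE pE bE iE => [|i] dE cE pE bE iE.
  rewrite -[RHS]Tvar; apply: eq_Rintegral => w _.
  by rewrite /defect /expo_prim /expo !mul0r oppr0 expR0 mulr1.
have c0 : 0 < i.+1%:R * eta by rewrite mulr_gt0.
pose c := i.+1%:R * eta.
have -> : \int[P]_w defect (expo_prim eta i.+1) (expo eta i.+1) w =
  \int[P]_w (c^-1 * (T w - m) - c^-1 * ((T w - m) * expR (- (c * T w)) +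
    2 * c * (Q w * expR (- (c * T w))))).
  apply: eq_Rintegral => w _; rewrite /defect /expo_prim /expo -/c.
  by field; rewrite gt_eqF.
have iT : P.-integrable setT (EFin \o (fun w => T w - m)).
  apply: (integrableB_EFin _ (integrable_cst_prob P m)).
  apply: dominated_integrable iD => // w; rewrite ger0_norm//.
  by have /andP[_] := pow_D w (isT : 1 <= 3)%N.
have iTe : P.-integrable setT (EFin \o (fun w => (T w - m) * expR (- (c * T w)) +
    2 * c * (Q w * expR (- (c * T w))))).
  have := integrableB_EFin iT (integrableZ_EFin c iE).
  congr (P.-integrable setT _); apply/funext => w /=; congr EFin.
  by rewrite /defect /expo_prim /expo -/c; field; rewrite gt_eqF.
rewrite RintegralB//; [|exact: integrableZ_EFin|exact: integrableZ_EFin].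
by rewrite !RintegralZl// Tmean Tlap// !mulr0 subrr.
Qed.

(** The hypotheses are the identity for constants, for the identity function
    and for decaying exponentials, so the defect of a combination of these
    vanishes.  For a general [psi], approximate [psi x * expR (- eta * x)] within [eta] by a polynomial in
    [expR (- eta * x)]; then [psi] itself is approximated within
    [eta * (1 + K * x)], which the third moment of [T] absorbs as [eta] tends
    to 0. *)
Lemma laplace_extension (f psi : R -> R) (K : R) :
  (forall x, is_derive x (1 : R) f (psi x)) -> continuous psi ->
  (forall x, `|psi x| <= K) ->
  P.-integrable setT (EFin \o (fun w => (T w - m) * f (T w) - 2 * (Q w * psi (T w)))) /\
  \int[P]_w ((T w - m) * f (T w) - 2 * (Q w * psi (T w))) = 0.
Proof.
move=> df cpsi psiK; have cf := is_derive_continuous df.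
have K0 : 0 <= K := le_trans (normr_ge0 _) (psiK 0).
have fK x : 0 <= x -> `|f x| <= `|f 0| + K * x + K * x ^+ 2.
  move=> x0; have h := increment_le_derive_bound df x0 (fun y _ => psiK y).
  rewrite -[f x](subrK (f 0)) (le_trans (ler_normD _ _))// addrC -addrA lerD2l.
  by rewrite (le_trans h)// lerDl mulr_ge0 ?sqr_ge0.
have pK x : 0 <= x -> `|psi x| <= K + K * x.
  by move=> x0; rewrite (le_trans (psiK x))// lerDl mulr_ge0.
have [id _] := integrable_defect (normr_ge0 (f 0)) K0 cf cpsi fK pK.
split=> //; apply/eqP; rewrite -normr_le0; apply/ler_addgt0Pr => e e0; rewrite add0r.
have [ID defID] : exists ID, ID = \int[P]_w D w by exists (\int[P]_w D w).
pose C := (0 + 2 * (1 + K)) * (1 + `|m|) * (2 + 4 * L) * ID.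
have C0 : 0 <= C.
  have ID0 : 0 <= ID by rewrite defID; apply: Rintegral_ge0 => w _; rewrite addr_ge0// exprn_ge0.
  apply: mulr_ge0 => //; apply: mulr_ge0; first apply: mulr_ge0.
  - by rewrite add0r mulr_ge0// addr_ge0.
  - by rewrite addr_ge0.
  - by rewrite addr_ge0// mulr_ge0.
(* C bounds the defect of the approximation error per unit of eta. *)
pose eta := e / (C + 1).
have C1 : 0 < C + 1 by rewrite ltr_wpDl.
have eta0 : 0 < eta by rewrite divr_gt0.
have [q Hq] := weierstrass01 (exp_weighted_continuous eta0 cpsi psiK) eta0.
pose psiq x := \sum_(i < size q) q`_i * expo eta i x.
pose fq x := \sum_(i < size q) q`_i * expo_prim eta i x.
have dfq x : is_derive x (1 : R) fq (psiq x).
  have -> : fq = \sum_(i < size q) (fun x => q`_i * expo_prim eta i x).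
    by apply/funext => y; rewrite fct_sumE.
  have dZ (i : 'I_(size q)) : is_derive x (1 : R) (fun x => q`_i * expo_prim eta i x) (q`_i * expo eta i x).
    have h := expo_prim_derive i x eta0; exact: (is_deriveZ q`_i h).
  exact: is_derive_sum.
have psiqE x : psiq x = q.[expR (- (eta * x))].
  rewrite horner_coef; apply: eq_bigr => i _; congr (_ * _).
  by rewrite /expo -expRM_natl; congr expR; ring.
have cpsiq : continuous psiq.
  rewrite (funext psiqE : psiq = _) => x.
  apply: (@continuous_comp _ _ _ (fun x : R => expR (- (eta * x))) (horner q)); last exact: continuous_horner.
  apply: continuous_comp; last exact: continuous_expR.
  by apply: cvgN; apply: cvgM; [exact: cvg_cst|exact: cvg_id].
have dq x : is_derive x (1 : R) (fun x => f x - f 0 - fq x) (psi x - psiq x).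
  have h1 := df x; have h2 := dfq x; apply: is_derive_eq; by rewrite subr0.
have dpsi x : 0 <= x -> `|psi x - psiq x| <= eta * (1 + K) + eta * (1 + K) * x.
  move=> x0; have ex1 : 0 <= expR (- (eta * x)) <= 1.
    by rewrite expR_ge0/= -expR0 ler_expR oppr_le0 mulr_ge0// ltW.
  have := Hq _ ex1; rewrite expRK opprK mulrAC divff ?gt_eqF// mul1r -psiqE => h.
  have h2 : `|psi x - psi x * expR (- (eta * x))| <= K * (eta * x).
    rewrite -{1}[psi x]mulr1 -mulrBr normrM ler_pM// ger0_norm.
      by have := expR_ge1Dx (- (eta * x)); lra.
    by rewrite subr_ge0; case/andP: ex1.
  rewrite (_ : psi x - psiq x = (psi x - psi x * expR (- (eta * x))) +
    (psi x * expR (- (eta * x)) - psiq x)); last by ring.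
  rewrite (le_trans (ler_normD _ _))// (le_trans (lerD h2 h))//.
  have := mulr_ge0 K0 (ltW eta0); have := mulr_ge0 (ltW eta0) x0; nra.
have b0 : 0 <= eta * (1 + K) by rewrite mulr_ge0 ?addr_ge0// ltW.
have dfb x : 0 <= x -> `|f x - f 0 - fq x| <= 0 + eta * (1 + K) * x + eta * (1 + K) * x ^+ 2.
  move=> x0.
  have := increment_le_derive_bound dq x0 (B := eta * (1 + K) + eta * (1 + K) * x).
  have -> : fq 0 = 0 by rewrite /fq big1// => i _; rewrite expo_prim0 mulr0.
  rewrite !subrr subr0 => /(_ _)/le_trans; apply.
    move=> y /andP[y0 yx]; rewrite (le_trans (dpsi _ y0))// lerD2l.
    exact: ler_wpM2l.
  by rewrite le_eqVlt; apply/orP; left; apply/eqP; ring.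
have [_ bnd] := integrable_defect (lexx 0) b0 (is_derive_continuous dq)
  (fun x => cvgB (cpsi x) (cpsiq x)) dfb dpsi.
have iq i := (defect_expo i eta0).1.
have EI : defect fq psiq =
    (fun w => \sum_(i < size q) q`_i * defect (expo_prim eta i) (expo eta i) w).
  apply/funext => w; rewrite /defect /fq /psiq !mulr_sumr -sumrB.
  by apply: eq_bigr => i _; ring.
have [Iq I0] : P.-integrable setT (EFin \o defect fq psiq) /\ \int[P]_w defect fq psiq w = 0.
  have iZ i := integrableZ_EFin q`_i (iq i).
  split; first by rewrite EI; apply: integrable_sum_EFin => i; exact: iZ.
  rewrite EI /= Rintegral_sum => [|i]; last exact: iZ.
  by apply: big1 => i _; rewrite RintegralZl// (defect_expo i eta0).2 mulr0.
have iT : P.-integrable setT (EFin \o (fun w => T w - m)).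
  apply: (integrableB_EFin _ (integrable_cst_prob P m)).
  apply: dominated_integrable iD => // w; rewrite ger0_norm//.
  by have /andP[_] := pow_D w (isT : 1 <= 3)%N.
have DE : defect (fun x => f x - f 0 - fq x) (fun x => psi x - psiq x) =
   (fun w => defect f psi w - (f 0 * (T w - m) + defect fq psiq w)).
  by apply/funext => w; rewrite /defect; ring.
move: bnd; rewrite -defID DE /= (RintegralB measurableT id (integrableD_EFin (integrableZ_EFin (f 0) iT) Iq)).
rewrite (RintegralD measurableT (integrableZ_EFin (f 0) iT) Iq).
rewrite RintegralZl// Tmean I0 mulr0 addr0 subr0 => /le_trans; apply.
rewrite (_ : _ * ID = eta * C); last by rewrite /C; ring.
by rewrite /eta mulrAC ler_pdivrMr// ler_wpM2l ?ltW// ltrDl.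
Qed.
End Extension.

(** * The Stein equation *)

Section Stein.
Variable R : realType.
Notation leb := (@lebesgue_measure R).
Notation p := (normal_pdf (0 : R) 1).

Let p_gt0 x : 0 < p x.
Proof. by rewrite normal_pdfE ?oner_neq0// mulr_gt0 ?expR_gt0// normal_peak_gt0// oner_neq0. Qed.

Let dp x : is_derive x (1 : R) p (- x * p x).
Proof.
have := @is_derive_normal_pdf R 0 1 x (oner_neq0 R).
by rewrite subr0 expr1n divr1.
Qed.

(** [normal_pdf 0 1 y / y +- G y] is nonincreasing on the positive half-line
    and tends to 0, hence is nonnegative. *)
Lemma gaussian_tail_bound (G k : R -> R) :
  (forall y, is_derive y (1 : R) G (k y)) -> (forall y, `|k y| <= p y) ->
  G n%:R @[n --> \oo] --> 0 -> forall x, 0 < x -> x * `|G x| <= p x.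
Proof.
move=> dG kp G0 x x0.
have key (e : R) : `|e| = 1 -> 0 <= p x / x + e * G x.
  move=> e1; pose A y := p y / y + e * G y.
  have dA (y : R) : 0 < y -> is_derive y (1 : R) A (- p y - p y / y ^+ 2 + e * k y).
    move=> y0; have h1 := dp y; have h2 := dG y.
    have h3 := @is_deriveV _ id y _ 1 (lt0r_neq0 y0) (is_derive_id y 1).
    apply: is_derive_eq; rewrite /GRing.scale /=.
    by field; rewrite gt_eqF.
  have Amono (y : R) : x <= y -> A y <= A x.
    rewrite le_eqVlt => /predU1P[->//|xy]; rewrite -subr_le0.
    have [z||z zxy ->] := @MVT R A (fun y => - p y - p y / y ^+ 2 + e * k y) x y xy.
    - by rewrite in_itv/= => /andP[xz _]; apply: dA; exact: lt_trans xz.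
    - apply: derivable_within_continuous => z; rewrite in_itv/= => /andP[xz _].
      have dz := dA z (lt_le_trans x0 xz); exact: (@ex_derive _ _ _ _ _ _ _ dz).
    - rewrite pmulr_lle0 ?subr_gt0//.
      have h1 : e * k z <= p z by rewrite (le_trans (ler_norm _))// normrM e1 mul1r.
      have h2 : 0 <= p z / z ^+ 2 by rewrite divr_ge0 ?sqr_ge0// ltW.
      lra.
  have A0 : A n%:R @[n --> \oo] --> (0 : R).
    have -> : (0 : R) = 0 + e * 0 by rewrite mulr0 addr0.
    apply: cvgD; last by apply: cvgM => //; exact: cvg_cst.
    apply/cvgr0Pnorm_le => r r0; near=> n.
    have n0 : 0 < n%:R :> R by rewrite ltr0n; near: n; exact: nbhs_infty_gt.
    rewrite ger0_norm; last by rewrite divr_ge0// ltW.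
    rewrite ler_pdivrMr//.
    rewrite (le_trans (normal_pdf_ub _ _ (oner_neq0 R)))// mulrC -ler_pdivrMr//.
    near: n; exact: nbhs_infty_ger.
  apply: (cvgr_to_le A0); near=> n; apply: Amono; near: n; exact: nbhs_infty_ger.
have k1 : `|(1 : R)| = 1 by rewrite normr1.
have k2 : `|(- 1 : R)| = 1 by rewrite normrN1.
have := key _ k1; have := key _ k2; rewrite mul1r mulN1r => h1 h2.
have : `|G x| <= p x / x by rewrite ler_norml; apply/andP; split; lra.
by rewrite ler_pdivlMr// mulrC.
Unshelve. all: by end_near. Qed.

(** The solution is
    [g x = (\int_(t <= x) (h t - c) * normal_pdf 0 1 t) / normal_pdf 0 1 x] with
    [c] the Gaussian mean of [h].  The tail bound, applied on both sides since
    the whole integral vanishes, gives [`|x * g x| <= 1], whence the bound 2 for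
    the derivative [x * g x + (h x - c)]. *)
Lemma stein_solution (h : R -> R) :
  continuous h -> (forall x, 0 <= h x <= 1) ->
  exists g psi : R -> R, [/\ forall x, is_derive x (1 : R) g (psi x),
    continuous psi, forall x, `|psi x| <= 2 &
    forall x, psi x - x * g x = h x - \int[normal_prob 0 1]_y h y].
Proof.
move=> ch h01; set c := (\int[normal_prob 0 1]_y h y).
have mh : measurable_fun setT h by exact: continuous_measurable_fun.
have hb x : `|h x| <= 1 by have /andP[? ?] := h01 x; rewrite ger0_norm.
have ih : (normal_prob 0 1).-integrable setT (EFin \o h).
  exact: (@integrable_bounded _ _ _ _ _ 1).
have c01 : 0 <= c <= 1.
  apply/andP; split; first by apply: Rintegral_ge0 => x _; case/andP: (h01 x).
  rewrite -(Rintegral_cst_prob (normal_prob 0 1 : probability (measurableTypeR R) R) 1).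
  apply: le_Rintegral => //; first exact: integrable_cst_prob.
  by move=> x _; case/andP: (h01 x).
have hc1 x : `|h x - c| <= 1.
  by have /andP[? ?] := h01 x; case/andP: c01 => ? ?; rewrite ler_norml; apply/andP; split; lra.
pose k x := (h x - c) * p x.
have cp : continuous p by apply: continuous_normal_pdf; exact: oner_neq0.
have ck : continuous k.
  by move=> x; apply: cvgM; [apply: cvgB; [exact: ch|exact: cvg_cst]|exact: cp].
have mhc : measurable_fun setT (fun x => h x - c) by exact: measurable_funB.
have hcg x : `|h x - c| <= 1 * (1 + (x - 0) ^+ 8).
  by rewrite (le_trans (hc1 x))// mul1r lerDl exprn_even_ge0.
have ik : leb.-integrable setT (EFin \o k) := growth_integrable (oner_neq0 R) mhc hcg.
have mk : measurable_fun setT k by exact: continuous_measurable_fun.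
have k0 : \int[leb]_x k x = 0.
  have [_ <-] := growth_normal (oner_neq0 R) mhc hcg.
  rewrite RintegralB//; last exact: integrable_cst_prob.
  by rewrite (Rintegral_cst_prob (normal_prob 0 1) c) subrr.
have kp x : `|k x| <= p x.
  by rewrite normrM [X in _ * X]ger0_norm ?normal_pdf_ge0// ler_piMl// normal_pdf_ge0.
pose F x := \int[leb]_(t in `]-oo, x]) k t.
have dF x : is_derive x (1 : R) F (k x).
  have x1 : x < x + 1 by rewrite ltrDl.
  have ikx : leb.-integrable [set` Interval (BInfty R true) (BRight (x + 1))] (EFin \o k).
    exact: integrableS ik.
  have [dFx F'x] := continuous_FTC1 x1 ikx (ltNyr x) (ck x).
  by apply: DeriveDef; [exact: dFx|rewrite -derive1E; exact: F'x].
have Fn : F n%:R @[n --> \oo] --> 0.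
  rewrite -k0; under eq_fun do rewrite /F Rintegral_mkcond.
  apply: (@Rintegral_dominated_cvg _ _ _ leb (fun n => k \_ `]-oo, n%:R]) k (fun x => `|k x|)) => //.
  - by move=> n; apply/(measurable_restrictT _ _).1 => //; exact: measurable_funTS.
  - move=> x; apply: cvg_near_cst; near=> n; rewrite patchE ifT// inE/= in_itv/=.
    near: n; exact: nbhs_infty_ger.
  - exact: integrable_norm.
  - by move=> n x; rewrite patchE; case: ifP => //; rewrite normr0.
have FNn : F (- n%:R) @[n --> \oo] --> 0.
  have -> : 0 = \int[leb]_x (cst 0 x : R) by rewrite Rintegral_cst// mul0r.
  under eq_fun do rewrite /F Rintegral_mkcond.
  apply: (@Rintegral_dominated_cvg _ _ _ leb (fun n => k \_ `]-oo, - n%:R]) (cst 0) (fun x => `|k x|)) => //.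
  - by move=> n; apply/(measurable_restrictT _ _).1 => //; exact: measurable_funTS.
  - move=> x; apply: cvg_near_cst; near=> n; rewrite patchE ifF//.
    apply/negbTE; rewrite notin_setE/= in_itv/=; apply/negP; rewrite -ltNge ltrNl.
    near: n; exact: nbhs_infty_gtr.
  - exact: integrable_norm.
  - by move=> n x; rewrite patchE; case: ifP => //; rewrite normr0.
have pN x : p (- x) = p x by rewrite !normal_pdfE ?oner_neq0// /normal_fun !subr0 sqrrN.
have dFN x : is_derive x (1 : R) (fun y => F (- y)) (- k (- x)).
  have h1 := dF (- x).
  have := @is_derive1_comp _ F -%R x _ _ h1 (is_deriveNid x 1).
  by rewrite mulrN1.
have bF x : `|x * F x| <= p x.
  have [x0|x0|->] := ltgtP x 0; last by rewrite mul0r normr0 ltW.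
    have := @gaussian_tail_bound _ _ dFN _ FNn (- x).
    rewrite oppr_gt0 opprK pN normrM (ltr0_norm x0) => /(_ _ x0); apply => y.
    by rewrite normrN -pN.
  rewrite normrM gtr0_norm//; exact: (gaussian_tail_bound dF kp Fn).
pose g x := F x / p x; pose psi x := x * g x + (h x - c).
have dg x : is_derive x (1 : R) g (psi x).
  have h1 := dF x; have h2 := @is_deriveV _ p x _ 1 (lt0r_neq0 (p_gt0 x)) (dp x).
  apply: is_derive_eq; rewrite /GRing.scale /= /psi /g /k.
  by field; rewrite gt_eqF.
exists g, psi; split => // x.
- apply: cvgD; last by apply: cvgB; [exact: ch|exact: cvg_cst].
  by apply: cvgM; [exact: cvg_id|exact: (is_derive_continuous dg)].
- rewrite (le_trans (ler_normD _ _))// (_ : 2 = 1 + 1)// lerD//.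
  by rewrite /g mulrA normrM normfV (gtr0_norm (p_gt0 x)) ler_pdivrMr// mul1r.
- by rewrite /psi; ring.
Unshelve. all: by end_near. Qed.
End Stein.

(** * Normal approximation of a weighted chi-square variable *)

Section SteinBound.
Context (R : realType) (d : measure_display) (Omega : measurableType d) (P : probability Omega R).

(** Stein's method.  With [Z = (T - m) / sigma] and the solution [g] of the
    Stein equation for [h], the hypotheses extended to the function
    [fun x => g ((x - m) / sigma)] say that the mean of [Z * g Z] is that of
    [2 * Q / sigma ^+ 2 * psi Z], where [psi] is the derivative of [g].  So the error
    is the mean of [psi Z * (1 - 2 * Q / sigma ^+ 2)], which is governed by the
    fluctuations of [Q]. *)
Lemma stein_bound (T Q : Omega -> R) (m L sigma : R) :
  measurable_fun setT T -> measurable_fun setT Q ->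
  (forall w, 0 <= T w) -> 0 < L -> (forall w, 0 <= Q w <= L * T w) ->
  P.-integrable setT (EFin \o (fun w => T w ^+ 3)) ->
  \int[P]_w (T w - m) = 0 ->
  \int[P]_w ((T w - m) * T w - 2 * Q w) = 0 ->
  (forall s, 0 < s -> \int[P]_w ((T w - m) * expR (- (s * T w)) +
      2 * s * (Q w * expR (- (s * T w)))) = 0) ->
  0 < sigma ->
  P.-integrable setT (EFin \o (fun w => (Q w - sigma ^+ 2 / 2) ^+ 2)) ->
  \int[P]_w ((Q w - sigma ^+ 2 / 2) ^+ 2) <= L ^+ 2 * sigma ^+ 2 ->
  forall h : R -> R, continuous h -> (forall x, 0 <= h x <= 1) ->
  `|\int[P]_w h ((T w - m) / sigma) - \int[normal_prob 0 1]_x h x| <= 4 * (L / sigma).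
Proof.
move=> mT mQ T0 L0 QL iT3 Tmean Tvar Tlap s0 iV Vle h ch h01.
have [g [psi [dg cpsi psi2 geq]]] := stein_solution ch h01.
move: (\int[normal_prob 0 1]_x h x) geq => c geq.
pose z x := (x - m) / sigma.
have dz x : is_derive x (1 : R) z sigma^-1.
  by apply: is_derive_eq; rewrite /GRing.scale /= subr0 mulr0 add0r mulr1.
have cz : continuous z := is_derive_continuous dz.
have df x : is_derive x (1 : R) (g \o z) (psi (z x) / sigma).
  exact: (is_derive1_comp (dg (z x)) (dz x)).
have cf' : continuous (fun x => psi (z x) / sigma).
  move=> x; apply: cvgM; last exact: cvg_cst.
  by apply: continuous_comp; [exact: cz|exact: cpsi].
have f'K x : `|psi (z x) / sigma| <= 2 / sigma.
  by rewrite normrM (@ger0_norm _ sigma^-1) ?invr_ge0 ?(ltW s0)// ler_pM2r ?invr_gt0.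
have [iE E0] := laplace_extension mT mQ T0 (ltW L0) QL iT3 Tmean Tvar Tlap df cf' f'K.
set Ew := (fun w => _ - _ : R) in iE; rewrite -/Ew in E0.
have mz : measurable_fun setT (fun w => z (T w)).
  exact: (measurableT_comp (continuous_measurable_fun cz) mT).
have mhz : measurable_fun setT (fun w => h (z (T w))).
  exact: (measurableT_comp (continuous_measurable_fun ch) mz).
have ihz : P.-integrable setT (EFin \o (fun w => h (z (T w)))).
  by apply: (@integrable_bounded _ _ _ _ _ 1) => // w; have /andP[? ?] := h01 (z (T w)); rewrite ger0_norm.
have ihc := integrableB_EFin ihz (integrable_cst_prob P c).
have -> : \int[P]_w h (z (T w)) - c = \int[P]_w (psi (z (T w)) * (1 - 2 * Q w / sigma ^+ 2)).
  transitivity (\int[P]_w ((h (z (T w)) - c) + sigma^-1 * Ew w)).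
    rewrite (RintegralD measurableT ihc (integrableZ_EFin _ iE)) RintegralZl// E0 mulr0 addr0.
    by rewrite RintegralB ?Rintegral_cst_prob//; exact: integrable_cst_prob.
  apply: eq_Rintegral => w _; rewrite -geq /Ew /=.
  by rewrite /z; field; rewrite gt_eqF.
(* The weight a in 2|y| <= a + y^2 / a that balances both terms. *)
pose a := L * sigma.
have a0 : 0 < a by rewrite mulr_gt0.
have s20 : 0 < sigma ^+ 2 by rewrite exprn_gt0.
have iB := integrableZ_EFin (2 / sigma ^+ 2)
  (integrableD_EFin (integrable_cst_prob P a) (integrableZ_EFin a^-1 iV)).
have bnd w : `|psi (z (T w)) * (1 - 2 * Q w / sigma ^+ 2)| <=
   2 / sigma ^+ 2 * (a + a^-1 * (Q w - sigma ^+ 2 / 2) ^+ 2).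
  rewrite normrM (le_trans (ler_wpM2r _ (psi2 _)))//.
  have -> : 1 - 2 * Q w / sigma ^+ 2 = - (2 / sigma ^+ 2 * (Q w - sigma ^+ 2 / 2)).
    by field; rewrite gt_eqF.
  rewrite normrN normrM (@gtr0_norm _ (2 / sigma ^+ 2)) ?divr_gt0// mulrCA ler_pM2l ?divr_gt0//.
  move: (Q w - sigma ^+ 2 / 2) => y.
  have h1 : 0 <= a^-1 * (`|y| - a) ^+ 2 by rewrite mulr_ge0 ?sqr_ge0// invr_ge0 ltW.
  have -> : a + a^-1 * y ^+ 2 = 2 * `|y| + a^-1 * (`|y| - a) ^+ 2.
    rewrite -[y ^+ 2]real_normK ?num_real//; field; rewrite gt_eqF//.
  by rewrite lerDl.
apply: (le_trans (Rintegral_norm_le _ bnd iB)).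
  apply: measurable_funM.
    exact: (measurableT_comp (continuous_measurable_fun cpsi) mz).
  by apply: measurable_funB => //; apply: measurable_funM => //; exact: measurable_funM.
rewrite RintegralZl//; last exact: (integrableD_EFin (integrable_cst_prob P a) (integrableZ_EFin a^-1 iV)).
rewrite (RintegralD measurableT (integrable_cst_prob P a) (integrableZ_EFin a^-1 iV)).
rewrite Rintegral_cst_prob RintegralZl//.
have -> : 4 * (L / sigma) = 2 / sigma ^+ 2 * (a + a^-1 * (L ^+ 2 * sigma ^+ 2)).
  by rewrite /a; field; rewrite !gt_eqF.
rewrite ler_pM2l ?divr_gt0// lerD2l ler_pM2l ?invr_gt0//.
Qed.

Variables (n : nat) (U : 'I_n -> Omega -> R) (l : 'I_n -> R).
Hypothesis mU : forall j, measurable_fun setT (U j).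
Hypothesis gaussU : forall a : 'I_n -> R,
  centred_gaussian P (fun w => \sum_j a j * U j w) (\sum_j a j ^+ 2 * l j).

(** Here [T] is the sum of the squares and [Q = \sum_j l j * U j ^+ 2].  Twice
    the mean of [Q] is the variance of [T], and the variance of [Q] is
    [2 * \sum_j l j ^+ 4 <= L ^+ 2 * sigma ^+ 2]: this is where the largest
    eigenvalue enters. *)
Lemma chi_square_stein_bound (L sigma : R) (h : R -> R) :
  0 < L -> (forall j, l j <= L) -> 0 < sigma ->
  sigma ^+ 2 = 2 * \sum_j l j ^+ 2 -> continuous h -> (forall x, 0 <= h x <= 1) ->
  `|\int[P]_w h ((\sum_j U j w ^+ 2 - \sum_j l j) / sigma) -
    \int[normal_prob 0 1]_x h x| <= 4 * (L / sigma).
Proof.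
move=> L0 lL s0 s2 ch h01.
have l0 j : 0 <= l j := coord_variance_ge0 gaussU j.
have iU2 j : P.-integrable setT (EFin \o (fun w => U j w ^+ 2)).
  by have [_ _ + _ _] := centred_gaussian_coord gaussU j; exact.
pose T w := \sum_j U j w ^+ 2; pose Q w := \sum_j l j * U j w ^+ 2.
pose m := \sum_j l j.
have iT : P.-integrable setT (EFin \o T) by exact: integrable_sum_EFin.
have iQ : P.-integrable setT (EFin \o Q).
  by apply: integrable_sum_EFin => j; exact: integrableZ_EFin.
have mT : measurable_fun setT T by apply: measurable_sum => j; exact: measurable_funX.
have mQ : measurable_fun setT Q.
  by apply: measurable_sum => j; apply: measurable_funM => //; exact: measurable_funX.
have T0 w : 0 <= T w by apply: sumr_ge0 => j _; exact: sqr_ge0.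
have QL w : 0 <= Q w <= L * T w.
  apply/andP; split; first by apply: sumr_ge0 => j _; rewrite mulr_ge0// sqr_ge0.
  by rewrite mulr_sumr; apply: ler_sum => j _; rewrite ler_wpM2r// sqr_ge0.
have IQ : \int[P]_w Q w = sigma ^+ 2 / 2.
  rewrite Rintegral_sum => [|j]; last exact: integrableZ_EFin.
  rewrite s2 mulrAC divff// mul1r; apply: eq_bigr => j _.
  by rewrite RintegralZl// (square_mean gaussU).
have IT : \int[P]_w T w = m.
  by rewrite Rintegral_sum//; apply: eq_bigr => j _; rewrite (square_mean gaussU).
have Tmean : \int[P]_w (T w - m) = 0.
  rewrite RintegralB//; last exact: integrable_cst_prob.
  by rewrite IT Rintegral_cst_prob subrr.
have TmE w : T w - m = \sum_j 1 * (U j w ^+ 2 - l j).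
  by rewrite -sumrB; apply: eq_bigr => j _; rewrite mul1r.
have QmE w : Q w - sigma ^+ 2 / 2 = \sum_j l j * (U j w ^+ 2 - l j).
  rewrite s2 mulrAC divff// mul1r -sumrB; apply: eq_bigr => j _.
  by rewrite mulrBr expr2.
have [iT2 IT2] := centred_form_variance mU gaussU (fun=> 1).
have [iQ2 IQ2] := centred_form_variance mU gaussU l.
apply: (@stein_bound T Q m L sigma) => //.
- exact: (square_norm_cube_integrable mU gaussU).
- have -> : (fun w => (T w - m) * T w - 2 * Q w) =
    (fun w => ((\sum_j 1 * (U j w ^+ 2 - l j)) ^+ 2 + m * (T w - m)) - 2 * Q w).
    by apply/funext => w; rewrite -TmE; ring.
  have iTm := integrableB_EFin iT (integrable_cst_prob P m).
  rewrite (RintegralB measurableT (integrableD_EFin iT2 (integrableZ_EFin m iTm)) (integrableZ_EFin 2 iQ)).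
  rewrite (RintegralD measurableT iT2 (integrableZ_EFin m iTm)) !RintegralZl// Tmean mulr0 addr0.
  rewrite IT2 IQ s2.
  under eq_bigr do rewrite expr1n mul1r.
  by field.
- move=> s s_gt0.
  have iW k := weighted_square_integrable mU gaussU k (ltW s_gt0).
  have iE : P.-integrable setT (EFin \o (fun w => expR (- (s * T w)))).
    apply: (@integrable_bounded _ _ _ _ _ 1) => [|w].
      by do 2 apply: measurableT_comp => //; exact: measurable_funM.
    by rewrite ger0_norm ?expR_ge0// -expR0 ler_expR oppr_le0 mulr_ge0// ltW.
  have -> : (fun w => (T w - m) * expR (- (s * T w)) + 2 * s * (Q w * expR (- (s * T w)))) =
    (fun w => \sum_k ((1 + 2 * s * l k) * (U k w ^+ 2 * expR (- (s * T w))) -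
       l k * expR (- (s * T w)))).
    apply/funext => w; move: (expR (- (s * T w))) => e.
    rewrite /m /Q /T -sumrB !mulr_suml mulr_sumr -big_split/=.
    by apply: eq_bigr => k _; ring.
  rewrite Rintegral_sum => [|k]; last exact: integrableB_EFin (integrableZ_EFin _ (iW k)) (integrableZ_EFin _ iE).
  apply: big1 => k _.
  rewrite (RintegralB measurableT (integrableZ_EFin _ (iW k)) (integrableZ_EFin _ iE)) !RintegralZl//.
  by rewrite (weighted_square_mean mU gaussU)// subrr.
- by under eq_fun do rewrite QmE.
- under eq_Rintegral do rewrite QmE.
  rewrite IQ2 s2 mulrCA ler_pM2l// mulr_sumr; apply: ler_sum => j _.
  by rewrite ler_wpM2r ?sqr_ge0// ler_pXn2r// nnegrE// ltW.
Qed.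
End SteinBound.

(** * Diagonalization of a Gaussian vector *)

Section Vector.
Context (R : realType) (d : measure_display) (Omega : measurableType d) (P : probability Omega R).

Lemma mfun_sumE I (r : seq I) (F : I -> {mfun Omega >-> R}) w :
  (\sum_(i <- r) F i) w = \sum_(i <- r) F i w.
Proof. by elim/big_ind2 : _ => // x1 x2 y1 y2 <- <-. Qed.

Lemma mfun_combE n (Y : 'I_n -> {RV P >-> R}) (a : 'I_n -> R) w :
  (\sum_i a i *: Y i : {mfun Omega >-> R}) w = \sum_i a i * Y i w.
Proof. by rewrite mfun_sumE. Qed.

Lemma fine_expectation (f : Omega -> R) : fine 'E_P[f] = \int[P]_w f w.
Proof. by rewrite unlock. Qed.

Variables (n : nat) (Y : 'I_n -> {RV P >-> R}).
Hypotheses (gY : gaussian_vector Y) (cY : centred Y).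

Let Y0 i : \int[P]_w Y i w = 0.
Proof. by rewrite -fine_expectation cY. Qed.

Let gaussY i : centred_gaussian P (Y i) (\int[P]_w (Y i w ^+ 2)).
Proof.
apply: gaussian_rv_centred_gaussian (Y0 i).
have := gY (fun k => (k == i)%:R); congr gaussian_rv.
apply/mfuneqP => w; rewrite mfun_combE (bigD1 i)//= eqxx mul1r big1 ?addr0// => k ki.
by rewrite (negbTE ki) mul0r.
Qed.

Let iY i k : (k <= 8)%N -> P.-integrable setT (EFin \o (fun w => Y i w ^+ k)).
Proof. by have [_ _ + _ _] := gaussY i; exact. Qed.

Lemma product_pair_integrable i k : P.-integrable setT (EFin \o (fun w => Y i w * Y k w)).
Proof.
apply: (@dominated_integrable _ _ _ _ _ (fun w => Y i w ^+ 2 + Y k w ^+ 2)).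
- exact: measurable_funM.
- move=> w; rewrite ler_norml; have := sqr_ge0 (Y i w + Y k w); have := sqr_ge0 (Y i w - Y k w).
  have := sqr_ge0 (Y i w); have := sqr_ge0 (Y k w).
  by move=> *; apply/andP; split; nra.
- exact: (integrableD_EFin (iY i (isT : 2 <= 8)%N) (iY k (isT : 2 <= 8)%N)).
Qed.

Lemma covariance_matrixE i k : covariance_matrix Y i k = \int[P]_w (Y i w * Y k w).
Proof. by rewrite mxE fine_expectation. Qed.

Lemma covariance_sym : (covariance_matrix Y)^T = covariance_matrix Y.
Proof.
apply/matrixP => i k; rewrite mxE !covariance_matrixE.
by apply: eq_Rintegral => w _; rewrite mulrC.
Qed.

Lemma centred_gaussian_linear_form (a : 'rV[R]_n) :
  centred_gaussian P (fun w => \sum_i a 0 i * Y i w) ((a *m covariance_matrix Y *m a^T) 0 0).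
Proof.
have := @gaussian_rv_centred_gaussian _ _ _ P _ (gY (fun i => a 0 i)).
have -> : (\sum_i a 0 i *: Y i : {mfun Omega >-> R}) = (fun w => \sum_i a 0 i * Y i w) :> (Omega -> R).
  by apply/funext => w; rewrite mfun_combE.
have iYZ i : P.-integrable setT (EFin \o (fun w => a 0 i * Y i w)).
  by apply: integrableZ_EFin; have := iY i (isT : 1 <= 8)%N.
rewrite Rintegral_sum// big1 => [|i _]; last first.
  by rewrite RintegralZl ?Y0 ?mulr0//; have := iY i (isT : 1 <= 8)%N.
move=> /(_ erefl); rewrite [X in centred_gaussian P _ X](_ : _ = (a *m covariance_matrix Y *m a^T) 0 0)//.
have iP i k : P.-integrable setT (EFin \o (fun w => (a 0 i * a 0 k) * (Y i w * Y k w))).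
  by apply: integrableZ_EFin; exact: product_pair_integrable.
transitivity (\int[P]_w \sum_k \sum_i (a 0 i * a 0 k) * (Y i w * Y k w)).
  apply: eq_Rintegral => w _; rewrite expr2 big_distrr/=; apply: eq_bigr => k _.
  by rewrite big_distrl/=; apply: eq_bigr => i _; ring.
rewrite Rintegral_sum => [|k]; last exact: integrable_sum_EFin.
rewrite mxE; apply: eq_bigr => k _; rewrite Rintegral_sum// !mxE big_distrl/=.
apply: eq_bigr => i _; rewrite RintegralZl//; last exact: product_pair_integrable.
by rewrite covariance_matrixE; ring.
Qed.

Variables (Q : 'M[R]_n) (D : 'rV[R]_n).
Hypotheses (QQ : Q *m Q^T = 1%:M) (QD : Q *m covariance_matrix Y *m Q^T = diag_mx D).

Definition rotated (j : 'I_n) (w : Omega) := \sum_i Q j i * Y i w.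

Lemma measurable_rotated j : measurable_fun setT (rotated j).
Proof. by apply: measurable_sum => i; apply: measurable_funM. Qed.

Lemma centred_gaussian_rotated (b : 'I_n -> R) :
  centred_gaussian P (fun w => \sum_j b j * rotated j w) (\sum_j b j ^+ 2 * D 0 j).
Proof.
pose bv := \row_j b j; have := centred_gaussian_linear_form (bv *m Q).
rewrite trmx_mul (_ : bv *m Q *m _ *m _ = bv *m (diag_mx D *m bv^T)); last first.
  by rewrite -QD !mulmxA.
have -> : (bv *m (diag_mx D *m bv^T)) 0 0 = \sum_j b j ^+ 2 * D 0 j.
  rewrite mxE; apply: eq_bigr => j _.
  by rewrite mul_diag_mx !mxE; ring.
congr (centred_gaussian P _ _); apply/funext => w.
transitivity (\sum_i \sum_j b j * Q j i * Y i w).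
  by apply: eq_bigr => i _; rewrite mxE big_distrl/=; apply: eq_bigr => j _; rewrite mxE.
rewrite exchange_big/=; apply: eq_bigr => j _; rewrite /rotated mulr_sumr.
by apply: eq_bigr => i _; rewrite mulrA.
Qed.

Lemma rotated_norm w : \sum_j rotated j w ^+ 2 = \sum_i Y i w ^+ 2.
Proof.
pose y := \row_i Y i w.
have rE j : rotated j w = (y *m Q^T) 0 j.
  by rewrite mxE; apply: eq_bigr => i _; rewrite !mxE mulrC.
have nE (v : 'rV[R]_n) : \sum_i v 0 i ^+ 2 = (v *m v^T) 0 0.
  by rewrite mxE; apply: eq_bigr => i _; rewrite mxE expr2.
under eq_bigr do rewrite rE.
rewrite nE trmx_mul trmxK mulmxA -(mulmxA y) (mulmx1C QQ) mulmx1 -nE.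
by apply: eq_bigr => i _; rewrite mxE.
Qed.

Lemma trace_rotated : \sum_j D 0 j = \sum_i covariance_matrix Y i i.
Proof.
by rewrite -[LHS]mxtrace_diag -QD mxtrace_mulC mulmxA (mulmx1C QQ) mul1mx.
Qed.

Lemma centred_square_sum_rotated w :
  centred_square_sum Y w = \sum_j rotated j w ^+ 2 - \sum_j D 0 j.
Proof.
rewrite trace_rotated rotated_norm /centred_square_sum mfun_sumE -sumrB.
by apply: eq_bigr => i _; rewrite mxE.
Qed.

Lemma variance_rotated : 'V_P[centred_square_sum Y] = (2 * \sum_j D 0 j ^+ 2)%:E.
Proof.
have gaussU := centred_gaussian_rotated.
have [iV IV] := centred_form_variance measurable_rotated gaussU (fun=> 1).
have VE w : centred_square_sum Y w = \sum_j 1 * (rotated j w ^+ 2 - D 0 j).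
  by rewrite centred_square_sum_rotated -sumrB; apply: eq_bigr => j _; rewrite mul1r.
have iU j : P.-integrable setT (EFin \o (fun w => rotated j w ^+ 2)).
  by have [_ _ + _ _] := centred_gaussian_coord gaussU j; exact.
have V0 : \int[P]_w centred_square_sum Y w = 0.
  under eq_Rintegral do rewrite centred_square_sum_rotated.
  rewrite RintegralB//; [|exact: integrable_sum_EFin|exact: integrable_cst_prob].
  rewrite (Rintegral_cst_prob P (\sum_j D 0 j)) Rintegral_sum//.
  under eq_bigr do rewrite (square_mean gaussU).
  exact: subrr.
rewrite /variance unlock fine_expectation V0.
have -> : (2 * \sum_j D 0 j ^+ 2)%:E = (\int[P]_w (centred_square_sum Y w ^+ 2))%:E.
  congr EFin; under eq_Rintegral do rewrite VE.
  by rewrite IV; congr (2 * _); apply: eq_bigr => j _; rewrite expr1n mul1r.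
rewrite unlock /Rintegral fineK; last first.
  apply: integrable_fin_num => //; apply: eq_integrable iV => // w _ /=.
  by rewrite VE.
apply: eq_integral => w _; congr EFin.
transitivity ((centred_square_sum Y w - 0) * (centred_square_sum Y w - 0)) => //.
by rewrite subr0 expr2.
Qed.
End Vector.

(** * Convergence of distribution functions *)

Section Ramp.
Variable R : realType.

(** [clip ((b - y) / (b - a))] to the unit interval, written with absolute values
    so that continuity is immediate. *)
Definition ramp (a b y : R) : R :=
  (`|(b - y) / (b - a)| - `|(b - y) / (b - a) - 1| + 1) / 2.

Lemma ramp_spec (a b y : R) : a < b ->
  [/\ 0 <= ramp a b y <= 1, y <= a -> ramp a b y = 1 & b <= y -> ramp a b y = 0].
Proof.
move=> ab; have ba : 0 < b - a by rewrite subr_gt0.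
rewrite /ramp; set t := (b - y) / (b - a).
have ya : y <= a -> 1 <= t by move=> ya; rewrite ler_pdivlMr// mul1r lerD2l lerN2.
have yb : b <= y -> t <= 0 by move=> yb; rewrite pmulr_lle0 ?invr_gt0// subr_le0.
split.
- by case: (ger0P t); case: (ger0P (t - 1)) => *; apply/andP; split; lra.
- by move/ya => t1; rewrite !ger0_norm; lra.
- by move/yb => t0; rewrite !ler0_norm; lra.
Qed.

Lemma ramp_continuous (a b : R) : continuous (ramp a b).
Proof.
move=> y.
have ct : {for y, continuous (fun y => (b - y) / (b - a))}.
  apply: cvgM; last exact: cvg_cst.
  by apply: cvgB; [exact: cvg_cst|exact: cvg_id].
apply: cvgM; last exact: cvg_cst.
apply: cvgD; last exact: cvg_cst.
apply: cvgB; first exact: cvg_norm.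
by apply: cvg_norm; apply: cvgB; [exact: ct|exact: cvg_cst].
Qed.
End Ramp.

Section CDF.
Context (R : realType) (d : measure_display) (Omega : measurableType d) (P : probability Omega R).

Lemma fine_probability d' (T : measurableType d') (nu : probability T R) (A : set T) :
  measurable A -> fine (nu A) = \int[nu]_x (\1_A x : R).
Proof. by move=> mA; rewrite /Rintegral integral_indic// setIT. Qed.

Lemma integrable_indic_prob d' (T : measurableType d') (nu : probability T R) (A : set T) :
  measurable A -> nu.-integrable setT (EFin \o (\1_A : T -> R)).
Proof.
move=> mA; apply: (@integrable_bounded _ _ _ _ _ 1) => // x.
by rewrite indicE; case: (_ \in _); rewrite ?normr1 ?normr0.
Qed.

(** Indicators of half-lines are squeezed between ramps of width [dl]. *)
Lemma cdf_smooth_bounds (Z : {RV P >-> R}) (e dl x : R) : 0 < dl ->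
  (forall h : R -> R, continuous h -> (forall y, 0 <= h y <= 1) ->
    `|\int[P]_w h (Z w) - \int[normal_prob 0 1]_y h y| <= e) ->
  fine (normal_prob 0 1 `]-oo, x - dl]) - e <= fine (cdf Z x) <=
  fine (normal_prob 0 1 `]-oo, x + dl]) + e.
Proof.
move=> dl0 H.
have mA y : measurable (`]-oo, y]%classic : set (measurableTypeR R)) by [].
have mZ : measurable (Z @^-1` `]-oo, x]) by rewrite -[X in measurable X]setTI; exact: measurable_funPT.
have PZ : fine (cdf Z x) = \int[P]_w (\1_(Z @^-1` `]-oo, x]) w : R).
  by rewrite -fine_probability.
have hb (a b y : R) : a < b -> 0 <= ramp a b y <= 1 by move=> ab; have [] := ramp_spec y ab.
have ihZ (a b : R) : a < b -> P.-integrable setT (EFin \o (fun w => ramp a b (Z w))).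
  move=> ab; apply: (@integrable_bounded _ _ _ _ _ 1) => [|w].
    by apply: measurableT_comp => //; apply: continuous_measurable_fun; exact: ramp_continuous.
  by have /andP[? ?] := hb a b (Z w) ab; rewrite ger0_norm.
have ihN (a b : R) : a < b -> (normal_prob 0 1).-integrable setT (EFin \o ramp a b).
  move=> ab; apply: (@integrable_bounded _ _ _ _ _ 1) => [|y].
    by apply: continuous_measurable_fun; exact: ramp_continuous.
  by have /andP[? ?] := hb a b y ab; rewrite ger0_norm.
have indE (y z : R) : (\1_`]-oo, z] y : R) = (y <= z)%R%:R.
  by rewrite indicE mem_setE in_itv.
have indZ w : (\1_(Z @^-1` `]-oo, x]) w : R) = (Z w <= x)%R%:R.
  by rewrite -indE !indicE.
have up (a b y : R) : a < b -> (y <= a)%R%:R <= ramp a b y.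
  move=> ab; have [h01 h1 _] := ramp_spec y ab.
  by case: (leP y a) => ya; [rewrite h1|case/andP: h01].
have dn (a b y : R) : a < b -> ramp a b y <= (y <= b)%R%:R.
  move=> ab; have [h01 _ h0] := ramp_spec y ab.
  by case: (leP y b) => yb; [case/andP: h01|rewrite h0// ltW].
rewrite PZ !fine_probability//; apply/andP; split.
- have ab : x - dl < x by rewrite gtrBl.
  have := H _ (@ramp_continuous _ (x - dl) x) (fun y => hb _ _ y ab).
  rewrite ler_norml => /andP[h1 _].
  have h2 : \int[normal_prob 0 1]_y (\1_`]-oo, x - dl] y : R) <= \int[normal_prob 0 1]_y ramp (x - dl) x y.
    apply: le_Rintegral => //; [exact: integrable_indic_prob|exact: ihN|].
    by move=> y _; rewrite indE; exact: up.
  have h3 : \int[P]_w ramp (x - dl) x (Z w) <= \int[P]_w (\1_(Z @^-1` `]-oo, x]) w : R).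
    apply: le_Rintegral => //; [exact: ihZ|exact: integrable_indic_prob|].
    by move=> w _; rewrite indZ; exact: dn.
  by apply: le_trans h3; rewrite lerBlDr (le_trans h2)// -lerBlDl -lerN2 opprB.
- have ab : x < x + dl by rewrite ltrDl.
  have := H _ (@ramp_continuous _ x (x + dl)) (fun y => hb _ _ y ab).
  rewrite ler_norml => /andP[_ h1].
  have h2 : \int[normal_prob 0 1]_y ramp x (x + dl) y <= \int[normal_prob 0 1]_y (\1_`]-oo, x + dl] y : R).
    apply: le_Rintegral => //; [exact: ihN|exact: integrable_indic_prob|].
    by move=> y _; rewrite indE; exact: dn.
  have h3 : \int[P]_w (\1_(Z @^-1` `]-oo, x]) w : R) <= \int[P]_w ramp x (x + dl) (Z w).
    apply: le_Rintegral => //; [exact: integrable_indic_prob|exact: ihZ|].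
    by move=> w _; rewrite indZ; exact: up.
  by apply: (le_trans h3); rewrite -lerBlDl (le_trans _ h1)// lerD2l lerN2.
Qed.
End CDF.

Theorem corollary2p1 (R : realType) (d : measure_display)
    (Omega : measurableType d) (P : probability Omega R)
    (I : Type) (X : I -> {RV P >-> R})
    (Y : forall n : nat, 'I_n -> {RV P >-> R})
    (lambda : forall n : nat, 'I_n -> R) :
  gaussian_process X -> centred X -> separable_process X ->
  (forall n : nat, (0 < n)%N ->
     [/\ gaussian_vector (Y n), centred (Y n) &
         forall k : 'I_n, first_chaos X (Y n k)]) ->
  (forall n : nat, (0 < n)%N ->
     eigenvalues (covariance_matrix (Y n)) (lambda n)) ->
  let V := fun n : nat => centred_square_sum (Y n) in
  let sd := fun n : nat => Num.sqrt (fine 'V_P[V n]) : R in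
  let lambda_star := fun n : nat => \big[Num.max/0]_(k < n) `|lambda n k| : R in
  (forall n : nat, (0 < n)%N -> (0 < 'V_P[V n])%E) ->
  lambda_star =o_\oo sd ->
  let Z := fun n : nat =>
    ((sd n)^-1 *: (V n : {mfun Omega >-> R}) : {RV P >-> R}) in
  cvg_in_distribution Z (normal_prob 0 1).
Proof.
move=> _ _ _ HY Hev V sd lambda_star Vpos Hlo Z x cx.
have bound (e : R) : 0 < e -> \forall n \near \oo, forall h : R -> R, continuous h ->
    (forall y, 0 <= h y <= 1) ->
    `|\int[P]_w h (Z n w) - \int[normal_prob 0 1]_y h y| <= 4 * e.
  move=> e0; move/eqoP : Hlo => /(_ _ e0); apply: filterS2 (nbhs_infty_gt 0) => n n0 lsd h ch h01.
  have [gY cY _] := HY n n0.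
  have ev := Hev n n0.
  have [|Q [D [QQ QD]]] := orthogonal_diagonalization (A := covariance_matrix (Y n)) (s :=
    [seq lambda n k | k <- index_enum 'I_n]) (covariance_sym (Y n)).
    by rewrite ev big_map.
  have VV := variance_rotated gY cY QQ QD.
  have v0 : 0 < 2 * \sum_j D 0 j ^+ 2 by have := Vpos n n0; rewrite VV lte_fin.
  have sdE : sd n ^+ 2 = 2 * \sum_j D 0 j ^+ 2 by rewrite /sd VV/= sqr_sqrtr// ltW.
  have s0 : 0 < sd n by rewrite /sd VV/= sqrtr_gt0.
  have DL j : D 0 j <= e * sd n.
    have := diagonal_entry_root j QQ QD.
    rewrite ev -(big_map (lambda n) xpredT (fun x => 'X - x%:P)) root_prod_XsubC.
    move=> /mapP[k _ ->]; rewrite (le_trans (ler_norm _))//.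
    rewrite (@le_trans _ _ (lambda_star n))//; first by rewrite /lambda_star; exact: le_bigmax.
    by rewrite (le_trans (ler_norm _))// (le_trans lsd)// (gtr0_norm s0).
  have := chi_square_stein_bound (measurable_rotated _ Q) (centred_gaussian_rotated gY cY QD)
     (mulr_gt0 e0 s0) DL s0 sdE ch h01.
  rewrite mulfK ?gt_eqF//; congr (`| _ - _ | <= _).
  apply: eq_Rintegral => w _; congr h.
  by rewrite -(centred_square_sum_rotated QQ QD) mulrC.
pose Phi (y : R) := fine (normal_prob 0 1 `]-oo, y]).
have cPhi : Phi y @[y --> x] --> Phi x.
  apply: fine_cvg; rewrite fineK; first exact: cx.
  exact: fin_num_measure.
rewrite -[X in _ --> X]fineK; last exact: fin_num_measure.
apply/fine_cvgP; split; first by apply: nearW => n; exact: fin_num_measure.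
apply/cvgrPdist_le => e e0 /=.
have e20 : 0 < e / 2 by rewrite divr_gt0.
have e80 : 0 < e / 8 by rewrite divr_gt0.
have [r /= r0 Hr] : exists2 r : R, 0 < r & forall y, `|x - y| < r -> `|Phi x - Phi y| <= e / 2.
  by move/cvgrPdist_le : cPhi => /(_ _ e20)/nbhs_ballP[r /= r0 Hr]; exists r.
have dl0 : 0 < r / 2 by rewrite divr_gt0.
move: (bound _ e80); apply: filterS => n Hn.
have /andP[h1 h2] := cdf_smooth_bounds x dl0 Hn.
have /Hr : `|x - (x - r / 2)| < r by rewrite opprB addrC subrK gtr0_norm//; lra.
have /Hr : `|x - (x + r / 2)| < r by rewrite opprD addrA subrr add0r normrN gtr0_norm//; lra.
rewrite /Phi !ler_norml => /andP[? ?] /andP[? ?]; apply/andP; split; lra.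
Qed.
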